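(* Let $\mathcal{T}=(S,s_{\mathit{init}},\to,L)$ be a finite transition system in which all maximal paths have the same finite length $k$. Let $E$ be a set of terminal states, all carrying the same label, and let $C\subseteq S$ be a set of states disjoint from $E$. Let $\Phi=\Diamond E$ or $\Phi=\Box\neg E$, and let $\pi=s_0\dots s_n$ be a maximal path visiting $C$ and satisfying $\Phi$. Then it is decidable in polynomial time whether $C$ is a $d_{\mathit{Hamm}}$-counterfactual cause for $\Phi$ on $\pi$.
   Context: A transition system is $\mathcal{T}=(S,s_{\mathit{init}},\to,L)$ with finite state set $S$, initial state $s_{\mathit{init}}$, transition relation $\to\subseteq S\times S$ and labeling $L\colon S\to 2^{\mathsf{AP}}$. A path is a finite or infinite sequence of states starting in $s_{\mathit{init}}$ following transitions; its trace is the sequence of labels. A state is terminal if it has no outgoing transitions; a maximal path is infinite or ends in a terminal state. For a distance function $d$ on maximal paths and a maximal path $\pi$ visiting $C$ and satisfying $\Phi$, $C$ is a $d$-counterfactual cause for $\Phi$ on $\pi$ if (1) some maximal path does not visit $C$, and (2) every maximal path $\rho$ with $\rho\models\Box\neg C$ whose distance $d(\pi,\rho)$ is minimal among all maximal paths avoiding $C$ satisfies $\rho\models\neg\Phi$. For words $w=w_0\dots w_n$, $v=v_0\dots v_n$ of equal length, $d_{\mathit{Hamm}}(w,v)=|\{i: w_i\ne v_i\}|$, and for maximal paths of equal length $d_{\mathit{Hamm}}(\pi,\rho)=d_{\mathit{Hamm}}(L(\pi),L(\rho))$. *)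

(* Defs.v *)
From HB Require Import structures.
From mathcomp Require Import all_boot all_order.

Set Implicit Arguments.
Unset Strict Implicit.
Unset Printing Implicit Defensive.

Import Order.TTheory.

Record transition_system (S AP : finType) := TransitionSystem {
  init : S;
  trans : rel S;
  label : S -> {set AP}
}.

Inductive state_sequence (S : Type) :=
  | Fin of seq S
  | Inf of (nat -> S).

Section Paths.
Variables (S AP : finType) (T : transition_system S AP).

Definition terminal (s : S) : bool := [forall t, ~~ trans T s t].

Definition is_path (rho : state_sequence S) : Prop :=
  match rho with
  | Fin [::] => False
  | Fin (s :: p) => s = init T /\ path (trans T) s p
  | Inf f => f 0 = init T /\ forall i, trans T (f i) (f i.+1)
  end.

Definition maximal_path (rho : state_sequence S) : Prop :=
  is_path rho /\
  match rho with
  | Fin w => terminal (last (init T) w)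
  | Inf _ => True
  end.

(* Length is counted in states; an infinite path has no finite length. *)
Definition has_length (rho : state_sequence S) (k : nat) : Prop :=
  if rho is Fin w then size w = k else False.

Definition state_at (rho : state_sequence S) (i : nat) : option S :=
  match rho with
  | Fin w => onth w i
  | Inf f => Some (f i)
  end.

End Paths.

(* [Dia A] is "eventually A" and [Box A] is "always A", for a set of states A
   read as a state predicate. *)
Inductive formula (S : finType) :=
  | Dia of {set S}
  | Box of {set S}.

Definition sat (S : finType) (rho : state_sequence S) (Phi : formula S) : Prop :=
  match Phi with
  | Dia A => exists i s, state_at rho i = Some s /\ s \in A
  | Box A => forall i s, state_at rho i = Some s -> s \in A
  end.

(* The notion is meant for a maximal path [pi] that visits [C] and satisfies
   [Phi]; these preconditions are left to the user of the definition. *)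
Definition counterfactual_cause (S AP : finType) (T : transition_system S AP)
    (disp : Order.disp_t) (V : orderType disp)
    (d : state_sequence S -> state_sequence S -> V)
    (C : {set S}) (Phi : formula S) (pi : state_sequence S) : Prop :=
  let avoids rho := maximal_path T rho /\ sat rho (Box (~: C)) in
  (exists rho, maximal_path T rho /\ ~ sat rho (Dia C)) /\
  (forall rho, avoids rho ->
     (forall rho', avoids rho' -> (d pi rho <= d pi rho')%O) ->
     ~ sat rho Phi).

Definition hamming (A : eqType) (w v : seq A) : nat :=
  count (fun p => p.1 != p.2) (zip w v).

(* Only meaningful on finite paths of equal length; the value is junk
   otherwise. *)
Definition d_hamm (S AP : finType) (T : transition_system S AP)
    (pi rho : state_sequence S) : nat :=
  match pi, rho with
  | Fin w, Fin v => hamming (map (label T) w) (map (label T) v)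
  | _, _ => 0
  end.

Inductive move := MoveLeft | Stay | MoveRight.

Section TuringMachines.
Variable A : finType.

(* Tape alphabet: a blank, the input letters, and further work letters. *)
Definition tape_symbol (G : finType) : finType := option (A + G)%type.

Record turing_machine := TuringMachine {
  work_letter : finType;
  extra_tapes : nat;
  control : finType;
  start : control;
  (* [Some b] marks a halting control state with answer [b]. *)
  verdict : control -> option bool;
  delta : control -> {ffun 'I_extra_tapes.+1 -> tape_symbol work_letter} ->
          control *
          {ffun 'I_extra_tapes.+1 -> tape_symbol work_letter * move}
}.

(* A two-way infinite tape: the cells left of the head, nearest first, and
   the cells from the head rightwards; all cells not listed are blank. *)
Definition tape (G : finType) : Type :=
  (seq (tape_symbol G) * seq (tape_symbol G))%type.

Definition read (G : finType) (t : tape G) : tape_symbol G := head None t.2.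

Definition write_move (G : finType) (t : tape G)
    (a : tape_symbol G * move) : tape G :=
  let: (l, r) := (t.1, behead t.2) in
  match a.2 with
  | MoveLeft => (behead l, head None l :: a.1 :: r)
  | Stay => (l, a.1 :: r)
  | MoveRight => (a.1 :: l, r)
  end.

Variable M : turing_machine.

Definition config : Type :=
  (control M * {ffun 'I_(extra_tapes M).+1 -> tape (work_letter M)})%type.

Definition step (c : config) : config :=
  if verdict c.1 is Some _ then c else
  let: (q, act) := delta c.1 [ffun i => read (c.2 i)] in
  (q, [ffun i => write_move (c.2 i) (act i)]).

Definition init_config (w : seq A) : config :=
  (start M,
   [ffun i => if i == ord0 then ([::], [seq Some (inl a) | a <- w])
              else ([::], [::])]).

Definition answers_within (w : seq A) (t : nat) (b : bool) : Prop :=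
  exists2 n, n <= t & verdict (iter n step (init_config w)).1 = Some b.

End TuringMachines.

(* [Some b] is the bit [b], [None] is the separator #. *)
Definition letter : finType := option bool.

(* A set is its characteristic bit vector along the enumeration of its type,
   closed by #. *)
Definition encode_set (X : finType) (A : {set X}) : seq letter :=
  rcons [seq Some (x \in A) | x <- enum X] None.

(* One-hot; since the adjacency matrix of the system is part of the input,
   input lengths are polynomially related to those with binary indices. *)
Definition encode_state (S : finType) (s : S) : seq letter :=
  encode_set [set s].

Definition encode_formula (S : finType) (Phi : formula S) : seq letter :=
  match Phi with
  | Dia A => Some true :: encode_set A
  | Box A => Some false :: encode_set A
  end.

Definition encode_system (S AP : finType) (T : transition_system S AP) :
    seq letter :=
  encode_state (init T)
  ++ flatten [seq encode_set [set t | trans T s t] | s <- enum S]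
  ++ flatten [seq encode_set (label T s) | s <- enum S].

(* The first block of the word gives #|S|, hence the number of blocks to read
   for each component; [pi] takes all the remaining blocks. *)
Definition encode_instance (S AP : finType) (T : transition_system S AP)
    (C : {set S}) (Phi : formula S) (pi : seq S) : seq letter :=
  encode_system T ++ encode_set C ++ encode_formula Phi
  ++ flatten [seq encode_state s | s <- pi].

(* Main.v *)
(** Since all maximal paths have the same length, every reachable state [s]
    has a unique depth, so that "the label of [s] differs from the label of
    [pi] at the depth of [s]" is a property of [s] alone; call such states
    mismatched. The Hamming distance from [pi] to a path is then the number of
    mismatched states on it. Let tokens spread from the initial state through
    all transitions that avoid [C], where entering a state takes one time unit,
    and one more if the state is mismatched. A terminal state is reached at a
    time that exceeds the distance of the path by the constant [k], so the
    first arrivals at terminal states are exactly the closest paths avoiding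
    [C], and [C] is a cause iff there is a first arrival and no first arrival
    satisfies [Phi]. As [E] is terminal, the latter only depends on the last
    state, both for [Dia E] and for [Box (~: E)].

    The machine is the compilation of a structured program whose loops all run
    at most as often as the input is long, which bounds its running time by a
    polynomial. *)
Require Import Defs.
From HB Require Import structures.
From mathcomp Require Import all_boot all_order.
From mathcomp Require Import zify.
From Stdlib Require Import Classical.

Set Implicit Arguments.
Unset Strict Implicit.
Unset Printing Implicit Defensive.

(** * Structured programs and their compilation *)

Lemma nth_map_ord (R : Type) (x0 : R) n (F : 'I_n -> R) i (lti : i < n) :
  nth x0 [seq F j | j <- enum 'I_n] i = F (Ordinal lti).
Proof.
by rewrite (nth_map (Ordinal lti)) ?size_enum_ord //
  (nth_ord_enum _ (Ordinal lti)).
Qed.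

(** For positive [N] one has [N + 2 <= 4 * N], and the additive term covers [N = 0]. One number
    serves as coefficient, exponent and summand because running times are stated as
    [c * n ^ c + c]. *)
Lemma poly_bound d N :
  (N.+2 ^ d).+1 <= 4 ^ d.+1 * N ^ (4 ^ d.+1) + 4 ^ d.+1.
Proof.
have mono a b : a <= b -> a ^ d <= b ^ d.
  by move=> ab; elim: d => // d IH; rewrite !expnS leq_mul.
have c0 : 0 < 4 ^ d by rewrite expn_gt0.
case: N => [|N].
  have := mono 2 4 isT; rewrite [4 ^ d.+1]expnS.
  by move: (2 ^ d) (4 ^ d) c0 => x y; nia.
have h1 : N.+3 ^ d <= 4 ^ d * N.+1 ^ d by rewrite -expnMn mono //; lia.
have h2 : N.+1 ^ d <= N.+1 ^ (4 ^ d.+1).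
  by rewrite leq_pexp2l // ltnW // (ltn_trans (ltnSn d)) // ltn_expl.
move: h1 h2 c0; rewrite ![4 ^ d.+1]expnS.
by move: (4 ^ d) (N.+1 ^ _) (N.+1 ^ _) (N.+3 ^ d) => x y z u; nia.
Qed.

Section Programs.
Variable G : finType.
Notation sym := (tape_symbol letter G).
Notation tp := (tape letter G).

(* Tapes are compared after removing the blanks at the far end of each half. *)
Definition strip_cons (a : sym) (r : seq sym) : seq sym :=
  if (a == None) && nilp r then [::] else a :: r.

Definition strip : seq sym -> seq sym := foldr strip_cons [::].

Definition strip_tape (z : tp) : tp := (strip z.1, strip z.2).

Lemma head_strip r : head None (strip r) = head None r.
Proof. by case: r => //= -[a|] r; rewrite /strip_cons //=; case: nilP. Qed.

Lemma behead_strip r : behead (strip r) = strip (behead r).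
Proof.
by case: r => //= a r; rewrite /strip_cons; case: ifP => //= /andP[_ /nilP->].
Qed.

Lemma strip_id r : strip (strip r) = strip r.
Proof.
elim: r => //= a r IH; rewrite /strip_cons; case: ifP => //= h.
by rewrite IH /strip_cons h.
Qed.

Definition act_tape (z : tp) (a : sym * move) : tp :=
  strip_tape (write_move z a).

(** An action inspects a tape only through [head] and [behead], and both commute with [strip]; so
    machine runs can be followed on stripped tapes. *)
Lemma act_strip_tape z a :
  act_tape (strip_tape z) a = strip_tape (write_move z a).
Proof.
case: z a => l r [b []]; rewrite /act_tape /strip_tape /write_move /=;
by rewrite ?head_strip ?behead_strip ?strip_id.
Qed.

(** This is how a machine leaves a tape alone. Stripping is essential: writing back on an empty
    right half adds an explicit blank. *)
Lemma write_read z : strip_tape (write_move z (read z, Stay)) = strip_tape z.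
Proof. by case: z => l [|a r]. Qed.

Definition reads (s : seq tp) : seq sym := map (@read _ G) s.

(* [None] leaves the tape alone. *)
Definition action := nat -> option (sym * move).

Definition perform (a : action) (s : seq tp) : seq tp :=
  mkseq (fun i => let z := nth ([::], [::]) s i in
                  if a i is Some b then act_tape z b else z) (size s).

Inductive command :=
  | Act of (seq sym -> action)
  | Seq of command & command
  | While of (seq sym -> bool) & command.

Fixpoint loop (p : seq sym -> bool) (R : seq tp -> seq tp -> Prop) n s s' :=
  if n is n'.+1 then p (reads s) /\ exists2 s1, R s s1 & loop p R n' s1 s'
  else ~~ p (reads s) /\ s' = s.

(* Every loop runs at most [N] times, which makes execution polynomial in [N]
   without any cost bookkeeping. *)
Fixpoint exec (N : nat) (c : command) (s s' : seq tp) : Prop :=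
  match c with
  | Act f => s' = perform (f (reads s)) s
  | Seq a b => exists2 s1, exec N a s s1 & exec N b s1 s'
  | While p b => exists2 n, n <= N & loop p (exec N b) n s s'
  end.

Fixpoint cost (c : command) (N : nat) : nat :=
  match c with
  | Act _ => 1
  | Seq a b => cost a N + cost b N
  | While _ b => N * (cost b N).+1 + 1
  end.

(** As the base is at least 2, one more in the exponent absorbs a sum of two bounds, and two more
    absorb the factor and the constants of a loop. *)
Lemma cost_poly c : exists d, forall N, cost c N <= N.+2 ^ d.
Proof.
elim: c => [f|a [d Hd] b [e He]|p b [d Hd]] /=.
- by exists 0.
- exists (maxn d e).+1 => N; rewrite expnS.
  have P x y : x <= y -> N.+2 ^ x <= N.+2 ^ y by apply: leq_pexp2l.
  have := P _ _ (leq_maxl d e); have := P _ _ (leq_maxr d e).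
  by have := Hd N; have := He N; nia.
- exists d.+2 => N; rewrite !expnS.
  have := Hd N; have : 0 < N.+2 ^ d by rewrite expn_gt0.
  by move: (N.+2 ^ d) (cost b N) => x y; nia.
Qed.

(** For a loop, [None] is the test and [Some] a control point in the body. *)
Fixpoint ctl (c : command) : finType :=
  match c with
  | Act _ => unit
  | Seq a b => (ctl a + ctl b)%type
  | While _ b => option (ctl b)
  end.

Fixpoint ini (c : command) : ctl c :=
  match c with
  | Act _ => tt
  | Seq a b => inl (ini a)
  | While _ b => None
  end.

(** A first component [None] means that this step completes the command. A loop test is a step of
    its own, which accounts for the successor and the final 1 in [cost]. *)
Fixpoint nxt (c : command) :
    ctl c -> seq sym -> option (ctl c) * action :=
  match c with
  | Act f => fun _ r => (None, f r)
  | Seq a b => fun q r =>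
    match q with
    | inl q => let: (q', x) := nxt q r in
               (Some (if q' is Some q1 then inl q1 else inr (ini b)), x)
    | inr q => let: (q', x) := nxt q r in (omap inr q', x)
    end
  | While p b => fun q r =>
    match q with
    | None => (if p r then Some (Some (ini b)) else None, fun=> None)
    | Some q => let: (q', x) := nxt q r in (Some q', x)
    end
  end.

Fixpoint reach t c (q : ctl c) (s s' : seq tp) : Prop :=
  if t isn't t'.+1 then False else
  let: (q', a) := nxt q (reads s) in
  if q' is Some q1 then reach t' q1 (perform a s) s'
  else t' = 0 /\ s' = perform a s.

Lemma perform_none s : perform (fun=> None) s = s.
Proof. exact: mkseq_nth. Qed.

Lemma reach_seqr a b t (q : ctl b) s s' :
  reach t q s s' -> reach t (inr q : ctl (Seq a b)) s s'.
Proof.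
by elim: t q s => //= t IH q s; case: (nxt q (reads s))
  => -[q1|] x //; exact: IH.
Qed.

Lemma reach_seql a b t u (q : ctl a) s s1 s' :
  reach t q s s1 -> reach u (ini b) s1 s' ->
  reach (t + u) (inl q : ctl (Seq a b)) s s'.
Proof.
elim: t q s => //= t IH q s.
case: (nxt q (reads s)) => -[q1|] x; first exact: IH.
by case=> -> ->; exact: reach_seqr.
Qed.

Lemma reach_while p b t u (q : ctl b) s s1 s' :
  reach t q s s1 -> reach u (ini (While p b)) s1 s' ->
  reach (t + u) (Some q : ctl (While p b)) s s'.
Proof.
elim: t q s => //= t IH q s.
case: (nxt q (reads s)) => -[q1|] x; first exact: IH.
by case=> -> ->; rewrite add0n.
Qed.

Lemma exec_reach N c s s' :
  exec N c s s' -> exists2 t, t <= cost c N & reach t (ini c) s s'.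
Proof.
elim: c s s' => [f|a IHa b IHb|p b IH] s s' /=.
- by move=> ->; exists 1.
- case=> s1 /IHa[t lt Ht] /IHb[u lu Hu]; exists (t + u); first by lia.
  exact: reach_seql Ht Hu.
(* The budget is generalized to [T], since the induction is on the actual number of rounds while [N]
   stays fixed in the execution of the body. *)
- case=> n; set T := _ + 1 => len H.
  have {}len : n * (cost b N).+1 + 1 <= T.
    by rewrite leq_add2r leq_mul2r len orbT.
  move: len; move: T => T.
  elim: n s T H => [|n IHn] s T /=.
    by case=> /negbTE p0 -> lT; exists 1; rewrite //= ?p0 ?perform_none //; lia.
  case=> ps [s1 /IH[t lt Ht] Hl] lT.
  have [|u lu Hu] := IHn s1 (T - t.+1) Hl; first by nia.
  exists (t + u).+1; first by nia.
  by rewrite /= ps perform_none; exact: reach_while Ht Hu.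
Qed.

(** * Translation of a command into a multi-tape Turing machine *)

Variables (K : nat) (main : command) (out : seq sym -> bool).

(** A verdict depends on the control state only, so the completed program enters [inr None], whose
    single step turns the symbols read into a halting state. *)
Definition compile : turing_machine letter :=
  @TuringMachine letter G K (ctl main + option bool)%type (inl (ini main))
    (fun q => if q is inr (Some b) then Some b else None)
    (fun q r =>
       let rs := [seq r i | i <- enum 'I_K.+1] in
       let: (q', a) :=
         match q with
         | inl q => let: (q', a) := nxt q rs in
                    (if q' is Some q1 then inl q1 else inr None, a)
         | inr _ => (inr (Some (out rs)), fun=> None)
         end in
       (q', [ffun i : 'I_K.+1 => odflt (r i, Stay) (a i)])).

Definition tapes (c : config compile) : seq tp :=
  [seq strip_tape (c.2 i) | i <- enum 'I_K.+1].

Lemma reads_tapes (c : config compile) :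
  [seq ([ffun i => read (c.2 i)] : {ffun 'I_K.+1 -> _}) i | i <- enum 'I_K.+1]
  = reads (tapes c).
Proof.
rewrite /reads /tapes -map_comp; apply/(@eq_map 'I_K.+1 sym) => i /=.
by rewrite ffunE /read /= head_strip.
Qed.

Lemma perform_tapes (c : config compile) (a : action) q :
  tapes (q, [ffun i => write_move (c.2 i)
    (([ffun i : 'I_K.+1 => odflt (([ffun i => read (c.2 i)]
         : {ffun 'I_K.+1 -> _}) i, Stay) (a i)]
       : {ffun 'I_K.+1 -> _}) i)])
  = perform a (tapes c).
Proof.
apply: (@eq_from_nth _ ([::], [::])); first by rewrite size_mkseq !size_map.
move=> i; rewrite size_map size_enum_ord => lti.
rewrite nth_mkseq; last by rewrite size_map size_enum_ord.
rewrite !(nth_map_ord _ _ lti) !ffunE /=.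
by case: (a i) => [b|] /=; rewrite ?act_strip_tape ?write_read.
Qed.

Lemma iter_reach t q f s' :
  reach t q (tapes (inl q, f)) s' ->
  exists2 f', iter t (@step _ compile) (inl q, f) = (inr None, f')
            & tapes (inr None, f') = s'.
Proof.
elim: t q f => // t IH q f; rewrite iterSr [reach _ _ _ _]/= {2}/step /=.
set x := [seq _ | _ <- _].
have Ex : x = reads (tapes (inl q, f)) by exact: (reads_tapes (inl q, f)).
rewrite Ex.
case: (nxt q _) => -[q1|] a.
  rewrite -(perform_tapes (inl q, f) a (inl q1)); exact: IH.
by case=> -> ->; eexists; last exact: (perform_tapes (inl q, f) a (inr None)).
Qed.

Lemma compile_answers : exists c, forall w s,
  exec (size w) main
    (([::], [seq Some (inl a) | a <- w]) :: nseq K ([::], [::])) s ->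
  answers_within compile w (c * size w ^ c + c) (out (reads s)).
Proof.
have [d Hd] := cost_poly main; exists (4 ^ d.+1) => w s /exec_reach[t lt].
set s0 := _ :: _ => Ht.
have E : tapes (inl (ini main), (init_config compile w).2) = s0.
  apply: (@eq_from_nth _ ([::], [::])).
    by rewrite size_map size_enum_ord /= size_nseq.
  move=> i; rewrite size_map size_enum_ord => lti.
  rewrite (nth_map_ord _ _ lti) ffunE; case: i lti => [|i] lti /=.
    by congr pair; elim: w {lt Ht s0 lti} => //= a w ->.
  by rewrite nth_nseq if_same.
rewrite -E in Ht; have [f' Ef Es] := iter_reach Ht.
(* The additional step is the one that evaluates [out]. *)
exists t.+1; last first.
  rewrite iterS [init_config _ _]surjective_pairing.
  by rewrite Ef /step /= (reads_tapes (inr None, f')) Es.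
by apply: leq_trans (poly_bound d (size w)); rewrite ltnS (leq_trans lt).
Qed.

End Programs.

Arguments While {G}.
Arguments Act {G}.

(** * Words on tapes and the return of a head to the start *)

Section Routines.
Variable G : finType.
Variable g0 : G.
Notation sym := (tape_symbol letter G).
Notation tp := (tape letter G).
Notation cmd := (command G).

Definition tok (a : letter) : sym := Some (inl a).
Definition bit (b : bool) : sym := tok (Some b).
Definition flag (g : G) : sym := Some (inr g).
Definition is_bit (x : sym) := if x is Some (inl (Some _)) then true else false.
Definition bit_of (x : sym) := x == bit true.
Definition flag_of (x : sym) := if x is Some (inr g) then g else g0.

Lemma bit_of_bit b : bit_of (bit b) = b. Proof. by case: b. Qed.

(* The tape holding [a ++ r], with the head on the first letter of [r]. *)
Definition zip_tape (a r : seq sym) : tp := strip_tape (rev a, r).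

Lemma zip_tape_blank (X : Type) (xs : seq X) :
  zip_tape [::] [seq None | _ <- xs] = ([::], [::]).
Proof. by congr pair; elim: xs => //= x xs ->. Qed.

Lemma zip_tape_word (u : seq letter) :
  zip_tape [::] [seq tok a | a <- u] = ([::], [seq Some (inl a) | a <- u]).
Proof. by congr pair; elim: u => //= x u ->. Qed.

Lemma read_zip a r : read (zip_tape a r) = head None r.
Proof. exact: head_strip. Qed.

Lemma act_zip_right a x r y :
  act_tape (zip_tape a (x :: r)) (y, MoveRight) = zip_tape (rcons a y) r.
Proof. by rewrite act_strip_tape /zip_tape rev_rcons. Qed.

Lemma act_zip_right_nil a y :
  act_tape (zip_tape a [::]) (y, MoveRight) = zip_tape (rcons a y) [::].
Proof. by rewrite act_strip_tape /zip_tape rev_rcons. Qed.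

Lemma act_zip_stay a x r y :
  act_tape (zip_tape a (x :: r)) (y, Stay) = zip_tape a (y :: r).
Proof. by rewrite act_strip_tape. Qed.

Lemma act_zip_left a x r :
  act_tape (zip_tape (rcons a x) r) (head None r, MoveLeft) =
  zip_tape a (x :: r).
Proof.
by case: r => [|y r]; rewrite act_strip_tape /zip_tape rev_rcons.
Qed.

Lemma act_zip_left_nil r :
  act_tape (zip_tape [::] r) (head None r, MoveLeft) =
  zip_tape [::] (None :: r).
Proof. by case: r => [|y r]; rewrite act_strip_tape. Qed.

Lemma act_zip_start r :
  act_tape (zip_tape [::] (None :: r)) (None, MoveRight) = zip_tape [::] r.
Proof. by rewrite act_zip_right. Qed.

Definition only (x : nat) (m : move) : cmd :=
  Act (fun r i => if i == x then Some (nth None r x, m) else None).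

Lemma exec_only N x m s :
  x < size s ->
  exec N (only x m) s
    (set_nth ([::], [::]) s x
       (act_tape (nth ([::], [::]) s x) (read (nth ([::], [::]) s x), m))).
Proof.
move=> ltx /=; apply: (@eq_from_nth _ ([::], [::])).
  by rewrite size_mkseq size_set_nth; apply/maxn_idPr.
rewrite size_set_nth (maxn_idPr ltx) => i lti.
rewrite nth_mkseq // nth_set_nth /=.
by case: eqP => [->|//]; rewrite (nth_map ([::], [::])).
Qed.

(** The head may start on the blank behind the word, so it moves left before the first test. The
    loop stops on the blank in front of the word, one cell too far. *)
Definition rewind (x : nat) : cmd :=
  Seq (only x MoveLeft)
    (Seq (While (fun r => nth None r x != None) (only x MoveLeft))
       (only x MoveRight)).

Lemma exec_rewind N x s a r :
  x < size s -> nth ([::], [::]) s x = zip_tape a r ->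
  None \notin a -> size a <= N ->
  exec N (rewind x) s (set_nth ([::], [::]) s x (zip_tape [::] (a ++ r))).
Proof.
move=> ltx Es a0 lea.
pose upd z := set_nth ([::], [::]) s x z.
have ltu z : x < size (upd z) by rewrite size_set_nth leq_maxl.
have nu z : nth ([::], [::]) (upd z) x = z by rewrite nth_set_nth /= eqxx.
have ru z : nth None (reads (upd z)) x = read z.
  by rewrite (nth_map ([::], [::])) ?nu.
have uu z z' : set_nth ([::], [::]) (upd z) x z' = upd z'.
  by rewrite /upd set_set_nth eqxx.
have step m z : exec N (only x m) (upd z) (upd (act_tape z (read z, m))).
  by have := exec_only N m (ltu z); rewrite nu uu.
exists (upd (act_tape (zip_tape a r) (head None r, MoveLeft))).
  by have := exec_only N MoveLeft ltx; rewrite Es read_zip.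
exists (upd (zip_tape [::] (None :: a ++ r))); last first.
  by have := step MoveRight (zip_tape [::] (None :: a ++ r));
     rewrite read_zip act_zip_start.
exists (size a) => //.
elim/last_ind: a r a0 {Es lea} => [|a y IH] r a0.
  by rewrite act_zip_left_nil /= ru read_zip.
rewrite size_rcons act_zip_left; split; rewrite ?ru ?read_zip /=.
  by apply: contraNneq a0 => <-; rewrite mem_rcons mem_head.
exists (upd (act_tape (zip_tape a (y :: r)) (y, MoveLeft))).
  by have := step MoveLeft (zip_tape a (y :: r)); rewrite read_zip.
rewrite cat_rcons; apply: (IH (y :: r)).
by apply: contra a0; rewrite mem_rcons inE => ->; rewrite orbT.
Qed.

End Routines.

(** * Scanning routines *)

#[local] Opaque zip_tape act_tape read.

Ltac run_step :=
  rewrite /= /perform /mkseq /= ?read_zip /= ?bit_of_bit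
    ?act_zip_right_nil ?act_zip_right ?act_zip_stay //.

Section Sweeps.
Variable G : finType.
Variable g0 : G.
Notation sym := (tape_symbol letter G).
Notation tp := (tape letter G).
Notation cmd := (command G).
Notation tok := (@tok G).
Notation bit := (@bit G).
Notation bit_of := (@bit_of G).
Notation flag_of := (flag_of g0).

Definition word_tape (a r : seq letter) : tp :=
  zip_tape (map tok a) (map tok r).

Definition col_tape (lt : bool) := if lt then 4 else 3.

(* The tapes are: the input; the path blocks of the input; the flags of each
   state; one bit per state; one bit per atomic proposition; the verdict. A
   sweep reads a matrix from the input, with the columns on the fourth or on
   the fifth tape. *)
Definition sweep_tapes lt (I P W C O R : tp) : seq tp :=
  [:: I; P; W; if lt then O else C; if lt then C else O; R].

(** On [enum X] this is convertible to [encode_set]; an arbitrary list permits induction. The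
    closing [None] is the letter #, which on a tape differs from a blank. *)
Definition block (T : Type) (b : T -> bool) (ts : seq T) : seq letter :=
  rcons [seq Some (b t) | t <- ts] None.

Lemma none_notin_map (T : Type) (f : T -> sym) ts :
  (forall t, f t != None) -> None \notin [seq f t | t <- ts].
Proof.
by move=> fN; elim: ts => //= t ts; rewrite inE eq_sym (negbTE (fN t)).
Qed.

Lemma map_tok_block (T : Type) (b : T -> bool) ts :
  map tok (block b ts) = rcons [seq bit (b t) | t <- ts] (tok None).
Proof. by rewrite /block map_rcons -map_comp. Qed.

Lemma map_tok_block_cat (T : Type) (b : T -> bool) ts r :
  map tok (block b ts ++ r) =
  [seq bit (b t) | t <- ts] ++ tok None :: map tok r.
Proof. by rewrite map_cat map_tok_block cat_rcons. Qed.

Lemma rewind_flags N lt I P (S : Type) (g : S -> G) ss C O R :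
  size ss <= N ->
  exec N (rewind G 2)
    (sweep_tapes lt I P (zip_tape [seq flag (g s) | s <- ss] [::]) C O R)
    (sweep_tapes lt I P (zip_tape [::] [seq flag (g s) | s <- ss]) C O R).
Proof.
move=> leN; set w := map _ _.
have nw : None \notin w by exact: none_notin_map.
have sw : size w <= N by rewrite size_map.
set s := sweep_tapes _ _ _ _ _ _ _.
have := @exec_rewind _ N 2 s w [::] isT erefl nw sw.
by rewrite cats0.
Qed.

Section Row.
Variables (lt : bool) (fc : G -> bool -> bool -> bool).
Variable fw : G -> bool -> bool -> G.

Definition scan_row : cmd :=
  While (fun r => is_bit (nth None r 0))
    (Act (fun r i =>
       let b := bit_of (nth None r 0) in
       let g := flag_of (nth None r 2) in
       let c := bit_of (nth None r (col_tape lt)) in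
       if i == 0 then Some (nth None r 0, MoveRight)
       else if i == 2 then Some (flag (fw g b c), Stay)
       else if i == col_tape lt then Some (bit (fc g b c), MoveRight)
       else None)).

Hypothesis fcw : forall g b c, fc (fw g b c) = fc g.

(** Later entries of the row see a flag already changed by earlier ones. By [fcw] the column update
    cannot tell the difference, so its result is stated with the original [g]. *)
Lemma exec_scan_row N (T : Type) (b : T -> bool) (c : T -> sym) ts
    ai ri P aw g rw ac rc O R :
  size ts <= N ->
  exec N scan_row
    (sweep_tapes lt
       (zip_tape ai ([seq bit (b t) | t <- ts] ++ tok None :: ri)) P
       (zip_tape aw (flag g :: rw))
       (zip_tape ac ([seq c t | t <- ts] ++ rc)) O R)
    (sweep_tapes lt
       (zip_tape (ai ++ [seq bit (b t) | t <- ts]) (tok None :: ri)) P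
       (zip_tape aw
          (flag (foldl (fun g t => fw g (b t) (bit_of (c t))) g ts) :: rw))
       (zip_tape (ac ++ [seq bit (fc g (b t) (bit_of (c t))) | t <- ts]) rc)
       O R).
Proof.
exists (size ts) => //.
elim: ts ai ac g {H} => [|t ts IH] ai ac g.
  by rewrite /= !cats0; split=> //; rewrite read_zip.
split; first by rewrite /= read_zip.
exists (sweep_tapes lt
  (zip_tape (rcons ai (bit (b t)))
     ([seq bit (b t) | t <- ts] ++ tok None :: ri)) P
  (zip_tape aw (flag (fw g (b t) (bit_of (c t))) :: rw))
  (zip_tape (rcons ac (bit (fc g (b t) (bit_of (c t)))))
     ([seq c t | t <- ts] ++ rc)) O R).
  by case: (lt); rewrite /= /perform /sweep_tapes /mkseq /= !read_zip /=
    ?bit_of_bit !act_zip_right act_zip_stay.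
have := IH (rcons ai (bit (b t))) (rcons ac (bit (fc g (b t) (bit_of (c t)))))
  (fw g (b t) (bit_of (c t))).
by rewrite !cat_rcons fcw.
Qed.


Definition sweep_row : cmd :=
  Seq scan_row
    (Seq (only G 0 MoveRight)
       (Seq (rewind G (col_tape lt)) (only G 2 MoveRight))).

Lemma exec_sweep_row N (T : Type) (b : T -> bool) (c : T -> sym) ts
    ai ri P aw g rw O R :
  size ts <= N ->
  exec N sweep_row
    (sweep_tapes lt (word_tape ai (block b ts ++ ri)) P
       (zip_tape aw (flag g :: rw)) (zip_tape [::] [seq c t | t <- ts]) O R)
    (sweep_tapes lt (word_tape (ai ++ block b ts) ri) P
       (zip_tape
          (rcons aw
             (flag (foldl (fun g t => fw g (b t) (bit_of (c t))) g ts))) rw)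
       (zip_tape [::] [seq bit (fc g (b t) (bit_of (c t))) | t <- ts]) O R).
Proof.
move=> leN; rewrite /sweep_row.
have := exec_scan_row b c (map tok ai) (map tok ri) P aw g rw [::] [::] O R leN.
rewrite !cats0 -map_tok_block_cat => H; eexists; first exact: H.
set g' := foldl _ _ _; set c' := [seq bit (fc _ _ _) | _ <- _].
exists (sweep_tapes lt (word_tape (ai ++ block b ts) ri) P
  (zip_tape aw (flag g' :: rw)) (zip_tape c' [::]) O R).
  by case: (lt); run_step; rewrite /word_tape map_cat map_tok_block rcons_cat.
have nc : None \notin c' by exact: none_notin_map.
have sc : size c' <= N by rewrite size_map.
exists (sweep_tapes lt (word_tape (ai ++ block b ts) ri) P
  (zip_tape aw (flag g' :: rw)) (zip_tape [::] c') O R).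
  set s := sweep_tapes _ _ _ _ _ _ _.
  have := @exec_rewind _ N (col_tape lt) s c' [::]; rewrite cats0 /s.
  by case: (lt) => /= /(_ isT erefl nc sc).
by case: (lt); run_step.
Qed.

Definition sweep : cmd :=
  Seq (While (fun r => nth None r 2 != None) sweep_row) (rewind G 2).

Lemma sweep_rows N (S T : Type) (b : S -> T -> bool) (g : S -> G)
    (c : T -> sym) ss ts ai ri aw P O R :
  size ts <= N ->
  (forall g b c, fw g b c = g) ->
  loop (fun r => nth None r 2 != None) (exec N sweep_row) (size ss)
    (sweep_tapes lt
       (word_tape ai (flatten [seq block (b s) ts | s <- ss] ++ ri)) P
       (zip_tape aw [seq flag (g s) | s <- ss])
       (zip_tape [::] [seq c t | t <- ts]) O R)
    (sweep_tapes lt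
       (word_tape (ai ++ flatten [seq block (b s) ts | s <- ss]) ri) P
       (zip_tape (aw ++ [seq flag (g s) | s <- ss]) [::])
       (zip_tape [::]
          [seq foldl (fun x s => bit (fc (g s) (b s t) (bit_of x))) (c t) ss
             | t <- ts]) O R).
Proof.
move=> leN wid; elim: ss ai aw c => [|s ss IH] ai aw c.
  by rewrite /= !cats0; split=> //; rewrite read_zip.
split; first by rewrite /= read_zip.
have := exec_sweep_row (b s) c ai (flatten [seq block (b s) ts | s <- ss] ++ ri)
  P aw (g s) [seq flag (g s) | s <- ss] O R leN.
have -> : foldl (fun g t => fw g (b s t) (bit_of (c t))) (g s) ts = g s.
  by elim: ts {leN IH} => //= t ts; rewrite wid.
rewrite /= -!catA => H; eexists; first exact: H.
have := IH (ai ++ block (b s) ts) (rcons aw (flag (g s)))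
  (fun t => bit (fc (g s) (b s t) (bit_of (c t)))).
by rewrite cat_rcons -!catA.
Qed.

(** Each column is folded over the rows. With a disjunction this is a Boolean vector-matrix product,
    giving successor sets; with a case distinction on the flag it extracts a row. *)
Lemma exec_sweep_cols N (S T : Type) (b : S -> T -> bool) (g : S -> G)
    (c : T -> sym) ss ts ai ri P O R :
  size ts <= N -> size ss <= N ->
  (forall g b c, fw g b c = g) ->
  exec N sweep
    (sweep_tapes lt
       (word_tape ai (flatten [seq block (b s) ts | s <- ss] ++ ri)) P
       (zip_tape [::] [seq flag (g s) | s <- ss])
       (zip_tape [::] [seq c t | t <- ts]) O R)
    (sweep_tapes lt
       (word_tape (ai ++ flatten [seq block (b s) ts | s <- ss]) ri) P
       (zip_tape [::] [seq flag (g s) | s <- ss])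
       (zip_tape [::]
          [seq foldl (fun x s => bit (fc (g s) (b s t) (bit_of x))) (c t) ss
             | t <- ts]) O R).
Proof.
move=> leT leS wid; eexists.
  by exists (size ss) => //; apply: sweep_rows.
exact: rewind_flags.
Qed.

(** The transposed use: each flag is folded along its row against a fixed vector, which compares all
    labels with a given one. *)
Lemma exec_sweep_rows N (S T : Type) (b : S -> T -> bool) (g : S -> G)
    (v : T -> bool) ss ts ai ri P O R :
  size ts <= N -> size ss <= N ->
  (forall g b c, fc g b c = c) ->
  exec N sweep
    (sweep_tapes lt
       (word_tape ai (flatten [seq block (b s) ts | s <- ss] ++ ri)) P
       (zip_tape [::] [seq flag (g s) | s <- ss])
       (zip_tape [::] [seq bit (v t) | t <- ts]) O R)
    (sweep_tapes lt
       (word_tape (ai ++ flatten [seq block (b s) ts | s <- ss]) ri) P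
       (zip_tape [::]
          [seq flag (foldl (fun g t => fw g (b s t) (v t)) (g s) ts) | s <- ss])
       (zip_tape [::] [seq bit (v t) | t <- ts]) O R).
Proof.
move=> leT leS cid; pose f s := foldl (fun g t => fw g (b s t) (v t)) (g s) ts.
exists (sweep_tapes lt
   (word_tape (ai ++ flatten [seq block (b s) ts | s <- ss]) ri) P
   (zip_tape [seq flag (f s) | s <- ss] [::])
   (zip_tape [::] [seq bit (v t) | t <- ts]) O R); last exact: rewind_flags.
exists (size ss) => //.
rewrite -[[seq flag (f _) | _ <- _]]cat0s.
move: ai {1 3}[::] => ai aw.
elim: ss {leS} ai aw => [|s ss IH] ai aw.
  by rewrite /= !cats0; split=> //; rewrite read_zip.
split; first by rewrite /= read_zip.
have := exec_sweep_row (b s) (fun t => bit (v t)) ai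
  (flatten [seq block (b s) ts | s <- ss] ++ ri)
  P aw (g s) [seq flag (g s) | s <- ss] O R leT.
rewrite (eq_map (g := fun t => bit (v t))); last first.
  by move=> t; rewrite cid bit_of_bit.
have -> : foldl (fun g t => fw g (b s t) (bit_of (bit (v t)))) (g s) ts = f s.
  rewrite /f; move: (g s); elim: (ts) => //= t ts' ih y.
  by rewrite ih bit_of_bit.
rewrite /= -!catA => H; eexists; first exact: H.
have := IH (ai ++ block (b s) ts) (rcons aw (flag (f s))).
by rewrite cat_rcons -!catA.
Qed.

End Row.

(** [src], coerced to 0 or 1, is the number of the tape holding [A], from which the vector is
    read. *)
Definition vec_tapes (src : bool) (A B W V L R : tp) : seq tp :=
  [:: if src then B else A; if src then A else B; W; V; L; R].

Definition scan_vector (src : bool) (h : G -> bool -> G) : cmd :=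
  Seq (While (fun r => is_bit (nth None r src))
    (Act (fun r i =>
       let x := nth None r src in
       if i == src then Some (x, MoveRight)
       else if i == 2
         then Some (flag (h (flag_of (nth None r 2)) (bit_of x)), MoveRight)
       else None)))
    (Seq (only G src MoveRight) (rewind G 2)).

(** The old symbols [w] may be blanks, which [flag_of] reads as [g0]; so the same routine also
    creates the flags. *)
Lemma exec_scan_vector N src h (S : Type) (b : S -> bool) (w : S -> sym) ss
    a r B V L R :
  size ss <= N ->
  exec N (scan_vector src h)
    (vec_tapes src (word_tape a (block b ss ++ r)) B
       (zip_tape [::] [seq w s | s <- ss]) V L R)
    (vec_tapes src (word_tape (a ++ block b ss) r) B
       (zip_tape [::] [seq flag (h (flag_of (w s)) (b s)) | s <- ss]) V L R).
Proof.
move=> leN; set w' := [seq flag _ | _ <- _].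
exists (vec_tapes src
    (zip_tape (map tok a ++ [seq bit (b s) | s <- ss]) (tok None :: map tok r))
    B (zip_tape w' [::]) V L R).
  exists (size ss) => //.
  rewrite -[w']cat0s {}/w' /word_tape map_tok_block_cat.
  move: (map tok a) {1 2}[::] => a' aw.
  elim: ss {leN} a' aw => [|s ss IH] a' aw.
    by rewrite /= !cats0; case: (src) => /=; rewrite read_zip.
  split; first by case: (src) => /=; rewrite read_zip.
  exists (vec_tapes src
    (zip_tape (rcons a' (bit (b s)))
       ([seq bit (b s) | s <- ss] ++ tok None :: map tok r)) B
    (zip_tape (rcons aw (flag (h (flag_of (w s)) (b s))))
       [seq w s | s <- ss]) V L R).
    by case: (src); run_step.
  have := IH (rcons a' (bit (b s)))
    (rcons aw (flag (h (flag_of (w s)) (b s)))).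
  by rewrite !cat_rcons.
exists (vec_tapes src (word_tape (a ++ block b ss) r) B
          (zip_tape w' [::]) V L R).
  by case: src; run_step; rewrite /word_tape map_cat map_tok_block rcons_cat.
have nw : None \notin w' by exact: none_notin_map.
have sw : size w' <= N by rewrite size_map.
set s := vec_tapes _ _ _ _ _ _ _.
have := @exec_rewind _ N 2 s w' [::] isT erefl nw sw.
by rewrite cats0.
Qed.

(** The bits are cleared after use, so that the next sweep can accumulate a disjunction in them. *)
Definition pointwise (fp : G -> bool -> G) (fr : G -> sym -> sym) : cmd :=
  Seq (While (fun r => nth None r 2 != None)
    (Act (fun r i =>
       let g := fp (flag_of (nth None r 2)) (bit_of (nth None r 3)) in
       if i == 2 then Some (flag g, MoveRight)
       else if i == 3 then Some (bit false, MoveRight)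
       else if i == 5 then Some (fr g (nth None r 5), Stay)
       else None)))
    (Seq (rewind G 2) (rewind G 3)).

Lemma exec_pointwise N fp fr (S : Type) (g : S -> G) (v : S -> bool) ss
    I P L x :
  size ss <= N ->
  exec N (pointwise fp fr)
    [:: I; P; zip_tape [::] [seq flag (g s) | s <- ss];
        zip_tape [::] [seq bit (v s) | s <- ss]; L; zip_tape [::] [:: x]]
    [:: I; P; zip_tape [::] [seq flag (fp (g s) (v s)) | s <- ss];
        zip_tape [::] [seq bit false | s <- ss]; L;
        zip_tape [::] [:: foldl (fun x s => fr (fp (g s) (v s)) x) x ss]].
Proof.
move=> leN; set w' := [seq flag (fp _ _) | _ <- _].
set v' := [seq bit false | _ <- _]; set x' := foldl _ _ _.
exists [:: I; P; zip_tape w' [::]; zip_tape v' [::]; L; zip_tape [::] [:: x']].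
  exists (size ss) => //.
  rewrite -[w']cat0s -[v']cat0s {}/w' {}/v' {}/x'.
  move: {1 5}[::] {1 5}[::] => av aw.
  elim: ss x av aw {leN} => [|s ss IH] x av aw.
    by rewrite /= !cats0 read_zip.
  split; first by rewrite /= read_zip.
  exists [:: I; P;
        zip_tape (rcons aw (flag (fp (g s) (v s)))) [seq flag (g s) | s <- ss];
        zip_tape (rcons av (bit false)) [seq bit (v s) | s <- ss]; L;
        zip_tape [::] [:: fr (fp (g s) (v s)) x]].
    by run_step.
  have := IH (fr (fp (g s) (v s)) x) (rcons av (bit false))
    (rcons aw (flag (fp (g s) (v s)))).
  by rewrite !cat_rcons.
have nw : None \notin w' by exact: none_notin_map.
have nv : None \notin v' by exact: none_notin_map.
have sw : size w' <= N by rewrite size_map.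
have sv : size v' <= N by rewrite size_map.
eexists.
  exact: (@exec_rewind _ N 2 [:: _; _; _; _; _; _] w' [::] isT erefl nw sw).
rewrite cats0 /=; set s := [:: _, _ & _].
by have := @exec_rewind _ N 3 s v' [::] isT erefl nv sv; rewrite cats0.
Qed.

Lemma exec_rewind_word N x s a r :
  x < size s -> nth ([::], [::]) s x = word_tape a r -> size a <= N ->
  exec N (rewind G x) s (set_nth ([::], [::]) s x (word_tape [::] (a ++ r))).
Proof.
move=> ltx Es lea; rewrite /word_tape map_cat.
apply: exec_rewind; rewrite ?size_map //.
by exact: none_notin_map.
Qed.

Definition split_off : cmd :=
  Seq (While (fun r => nth None r 0 != None)
    (Act (fun r i =>
       if i < 2 then Some (nth None r 0, MoveRight) else None)))
    (Seq (rewind G 0) (rewind G 1)).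

Lemma exec_split_off N a r W V L R :
  size (a ++ r) <= N ->
  exec N split_off
    [:: word_tape a r; word_tape [::] [::]; W; V; L; R]
    [:: word_tape [::] (a ++ r); word_tape [::] r; W; V; L; R].
Proof.
rewrite size_cat => leN.
exists [:: word_tape (a ++ r) [::]; word_tape r [::]; W; V; L; R].
  exists (size r); first by apply: leq_trans leN; exact: leq_addl.
  rewrite -[in X in loop _ _ _ _ X](cat0s r).
  move: {1 5}[::] => p; rewrite cat0s.
  elim: r a p {leN} => [|x r IH] a p.
    by rewrite /= !cats0 read_zip.
  split; first by rewrite /= read_zip.
  exists [:: word_tape (rcons a x) r; word_tape (rcons p x) [::]; W; V; L; R].
    by rewrite /word_tape !map_rcons; run_step.
  by have := IH (rcons a x) (rcons p x); rewrite !cat_rcons.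
eexists.
  apply: (@exec_rewind_word N 0 [:: _; _; _; _; _; _] (a ++ r) [::] isT erefl).
  by rewrite size_cat.
rewrite cats0 /=; set s := [:: _, _ & _].
have := @exec_rewind_word N 1 s r [::] isT erefl; rewrite cats0; apply.
by apply: leq_trans leN; exact: leq_addl.
Qed.

End Sweeps.

(** * The decision program *)

(* The flags of a state, in order: is in the cause; is in the set of the
   formula; is the current state of the given path; is in the current layer;
   is in the previous layer (so, after the last layer, is reachable and
   terminal); is mismatched; carries a token; will receive a delayed token. *)
Definition cell : finType :=
  (bool * bool * bool * bool * bool * bool * bool * bool)%type.

Definition cell0 : cell :=
  (false, false, false, false, false, false, false, false).

Section Program.
Notation sym := (tape_symbol letter cell).
Notation bit := (@bit cell).

(** The initial state forms the first layer. Its token is pending, so that the first tick places it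
    and tests the state against [C] like any other. *)
Definition mark_init (_ : cell) b : cell :=
  (false, false, false, b, false, false, false, b).
Definition mark_cause (g : cell) b : cell :=
  let: (_, a, p, l, f, m, x, d) := g in (b, a, p, l, f, m, x, d).
Definition mark_aim (g : cell) b : cell :=
  let: (c, _, p, l, f, m, x, d) := g in (c, b, p, l, f, m, x, d).
Definition mark_path (g : cell) b : cell :=
  let: (c, a, _, l, f, m, x, d) := g in (c, a, b, l, f, m, x, d).
Definition mark_mismatch (g : cell) (b b' : bool) : cell :=
  let: (c, a, p, l, f, m, x, d) := g in
  (c, a, p, l, f, m || (l && (b != b')), x, d).
Definition next_layer (g : cell) v : cell :=
  let: (c, a, p, l, _, m, x, d) := g in (c, a, p, v, l, m, x, d).
(** Here [v] says that some predecessor carries a token. A mismatched state holds it back for one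
    tick. *)
Definition move_tokens (g : cell) v : cell :=
  let: (c, a, p, l, f, m, _, d) := g in
  (c, a, p, l, f, m, ~~ c && (d || (~~ m && v)), m && v).
(** A single closest path satisfying the formula refutes causality, hence [bit false] takes
    precedence. *)
Definition judge (g : cell) (y : sym) : sym :=
  let: (_, a, _, _, f, _, x, _) := g in
  if x && f then
    if a then bit false else if y == bit false then y else bit true
  else y.

Definition on_path (g : cell) : bool :=
  let: (_, _, p, _, _, _, _, _) := g in p.
Definition in_layer (g : cell) : bool :=
  let: (_, _, _, l, _, _, _, _) := g in l.
Definition has_token (g : cell) : bool :=
  let: (_, _, _, _, _, _, x, _) := g in x.

Definition sweep_cols lt fc := sweep cell0 lt fc (fun g _ _ => g).
Definition skip := scan_vector cell0 false (fun g _ => g).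

(** The two constant sweeps fill the bit tapes with [false] and take the head past both matrices.
    The kind of the formula is skipped, as the encoded set already determines which last states
    satisfy it. *)
Definition prepare : command cell :=
  Seq (scan_vector cell0 false mark_init)
  (Seq (sweep_cols false (fun _ _ _ => false))
  (Seq (sweep_cols true (fun _ _ _ => false))
  (Seq (scan_vector cell0 false mark_cause)
  (Seq (only cell 0 MoveRight)
  (Seq (scan_vector cell0 false mark_aim) (split_off cell)))))).

(** One state of the given path is processed in two passes over the input: the first computes the
    successors of the layer and copies the label of the path state, the second compares labels. The
    sweep in between that keeps all columns only moves the head. *)
Definition layer : command cell :=
  Seq (scan_vector cell0 true mark_path)
  (Seq skip
  (Seq (sweep_cols false (fun g b c => c || (in_layer g && b)))
  (Seq (sweep_cols true (fun g b c => if on_path g then b else c))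
  (Seq (rewind cell 0)
  (Seq skip
  (Seq (sweep_cols false (fun _ _ c => c))
  (Seq (sweep cell0 true (fun _ _ c => c) mark_mismatch)
  (Seq (rewind cell 0) (pointwise cell0 next_layer (fun _ y => y)))))))))).

(** The path tape now serves as a clock: every tick uses up one letter. *)
Definition tick : command cell :=
  Seq skip
  (Seq (sweep_cols false (fun g b c => c || (has_token g && b)))
  (Seq (rewind cell 0)
  (Seq (pointwise cell0 move_tokens judge) (only cell 1 MoveRight)))).

Definition program : command cell :=
  Seq prepare
  (Seq (While (fun r => nth None r 1 != None) layer)
  (Seq (rewind cell 1)
    (While (fun r => (nth None r 1 != None) && (nth None r 5 == None)) tick))).

Definition accept (r : seq sym) : bool := nth None r 5 == bit true.

End Program.

(** * Effect of the program on layers, mismatches and tokens *)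

Section Correctness.
Variables (S AP : finType) (T : transition_system S AP) (C A : {set S}).
Variables (kind : bool) (pi : seq S).
Notation sym := (tape_symbol letter cell).
Notation tp := (tape letter cell).
Notation bit := (@bit cell).

Let ini := encode_state (init T).
Let adj := flatten [seq encode_set [set t | trans T s t] | s <- enum S].
Let labs := flatten [seq encode_set (label T s) | s <- enum S].
Let path := flatten [seq encode_state s | s <- pi].
Let tl := encode_set C ++ Some kind :: encode_set A ++ path.
Let w := ini ++ adj ++ labs ++ tl.
Let N := size w.

Definition cfg (I P : tp) (g : S -> cell) (V : S -> bool) (lab : AP -> bool)
    (R : sym) : seq tp :=
  [:: I; P; zip_tape [::] [seq flag (g s) | s <- enum S];
      zip_tape [::] [seq bit (V s) | s <- enum S];
      zip_tape [::] [seq bit (lab a) | a <- enum AP]; zip_tape [::] [:: R]].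

Lemma eq_cfg I P g g' V V' lab lab' R R' :
  g =1 g' -> V =1 V' -> lab =1 lab' -> R = R' ->
  cfg I P g V lab R = cfg I P g' V' lab' R'.
Proof.
move=> Eg EV El ->; rewrite /cfg.
have -> : [seq flag (g s) | s <- enum S] = [seq flag (g' s) | s <- enum S].
  by apply: eq_map => s; rewrite Eg.
have -> : [seq bit (V s) | s <- enum S] = [seq bit (V' s) | s <- enum S].
  by apply: eq_map => s; rewrite EV.
by congr [:: _; _; _; _; zip_tape _ _; _]; apply: eq_map => a; rewrite El.
Qed.

Lemma exec_to n c (s s1 s2 : seq tp) :
  exec n c s s1 -> s1 = s2 -> exec n c s s2.
Proof. by move=> H <-. Qed.

Lemma size_encode_set (X : finType) (B : {set X}) :
  size (encode_set B) = (size (enum X)).+1.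
Proof. by rewrite size_rcons size_map. Qed.

Lemma leq_size_flatten (X : eqType) (Y : Type) (f : X -> seq Y) x xs :
  x \in xs -> size (f x) <= size (flatten [seq f y | y <- xs]).
Proof.
elim: xs => //= y xs IH; rewrite inE size_cat => /orP[/eqP->|/IH h].
  exact: leq_addr.
exact: leq_trans h (leq_addl _ _).
Qed.

Lemma leq_states : size (enum S) <= N.
Proof.
by rewrite /N /w size_cat size_encode_set addSn ltnW // ltnS leq_addr.
Qed.

(** The input contains at least one label block, namely that of [init T]. *)
Lemma leq_labels : size (enum AP) <= N.
Proof.
have := @leq_size_flatten _ _ (fun s => encode_set (label T s)) (init T)
  (enum S) (mem_enum _ _).
rewrite size_encode_set -/labs /N /w !size_cat; lia.
Qed.

Lemma leq_path : size path <= N.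
Proof. rewrite /N /w /tl !size_cat /= !size_cat; lia. Qed.

Lemma exec_skip P g V lab R :
  exec N skip (cfg (word_tape _ [::] w) P g V lab R)
    (cfg (word_tape _ ini (adj ++ labs ++ tl)) P g V lab R).
Proof.
exact: (@exec_scan_vector _ cell0 N false (fun g _ => g) _
  (fun s => s \in [set init T]) (fun s => flag (g s)) (enum S)
  [::] _ P _ _ _ leq_states).
Qed.

Lemma exec_sweep_states fc P g (V : S -> bool) lab R :
  exec N (sweep_cols false fc)
    (cfg (word_tape _ ini (adj ++ labs ++ tl)) P g V lab R)
    (cfg (word_tape _ (ini ++ adj) (labs ++ tl)) P g
       (fun t => foldl (fun y s => fc (g s) (trans T s t) y) (V t) (enum S))
       lab R).
Proof.
have := (@exec_sweep_cols _ cell0 false fc (fun g _ _ => g)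
  (fun _ _ _ => erefl) N S S
  (fun s t => t \in [set t | trans T s t]) g (fun t => bit (V t)) (enum S)
  (enum S) ini (labs ++ tl) P (zip_tape [::] [seq bit (lab a) | a <- enum AP])
  (zip_tape [::] [:: R]) leq_states leq_states (fun _ _ _ => erefl)).
move=> H; rewrite /cfg; set V' := [seq bit (foldl _ _ _) | _ <- _].
have -> : V' = [seq foldl (fun x s =>
    bit (fc (g s) (t \in [set t | trans T s t]) (bit_of x)))
    (bit (V t)) (enum S) | t <- enum S]; last exact: H.
apply: eq_map => t; elim: (enum S) (V t) => //= s ss IH y.
by rewrite bit_of_bit inE IH.
Qed.

Lemma exec_sweep_labels fc P g V lab R :
  exec N (sweep_cols true fc)
    (cfg (word_tape _ (ini ++ adj) (labs ++ tl)) P g V lab R)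
    (cfg (word_tape _ (ini ++ adj ++ labs) tl) P g V
       (fun a =>
          foldl (fun y s => fc (g s) (a \in label T s) y) (lab a) (enum S)) R).
Proof.
have := (@exec_sweep_cols _ cell0 true fc (fun g _ _ => g)
  (fun _ _ _ => erefl) N S AP
  (fun s a => a \in label T s) g (fun a => bit (lab a)) (enum S)
  (enum AP) (ini ++ adj) tl P (zip_tape [::] [seq bit (V s) | s <- enum S])
  (zip_tape [::] [:: R]) leq_labels leq_states (fun _ _ _ => erefl)).
rewrite -catA => H; rewrite /cfg; set l' := [seq bit (foldl _ _ _) | _ <- _].
have -> : l' = [seq foldl (fun x s =>
    bit (fc (g s) (a \in label T s) (bit_of x)))
    (bit (lab a)) (enum S) | a <- enum AP]; last exact: H.
apply: eq_map => a; elim: (enum S) (lab a) => //= s ss IH y.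
by rewrite bit_of_bit IH.
Qed.

Lemma exec_mismatch P g V (lab : AP -> bool) R :
  exec N (sweep cell0 true (fun _ _ c => c) mark_mismatch)
    (cfg (word_tape _ (ini ++ adj) (labs ++ tl)) P g V lab R)
    (cfg (word_tape _ (ini ++ adj ++ labs) tl) P
       (fun s => foldl (fun g a => mark_mismatch g (a \in label T s) (lab a))
                   (g s) (enum AP)) V lab R).
Proof.
have := (@exec_sweep_rows _ cell0 true (fun _ _ c => c) mark_mismatch
  (fun _ _ _ => erefl) N S AP
  (fun s a => a \in label T s) g lab (enum S)
  (enum AP) (ini ++ adj) tl P (zip_tape [::] [seq bit (V s) | s <- enum S])
  (zip_tape [::] [:: R]) leq_labels leq_states (fun _ _ _ => erefl)).
by rewrite -catA.
Qed.

Lemma exec_rewind_input a r P g V lab R :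
  a ++ r = w ->
  exec N (rewind cell 0) (cfg (word_tape _ a r) P g V lab R)
    (cfg (word_tape _ [::] w) P g V lab R).
Proof.
move=> E; rewrite -E.
apply: (@exec_rewind_word _ N 0 (cfg (word_tape _ a r) P g V lab R) a r) => //.
by rewrite /N -E size_cat leq_addr.
Qed.

Definition cells (p l f m x d : S -> bool) (s : S) : cell :=
  (s \in C, s \in A, p s, l s, f s, m s, x s, d s).

Definition succs (l : S -> bool) (t : S) : bool :=
  [exists s, l s && trans T s t].

Lemma has_enum (X : finType) (P : pred X) : has P (enum X) = [exists s, P s].
Proof.
by apply/hasP/existsP => [[s _ Ps]|[s Ps]]; exists s; rewrite ?mem_enum.
Qed.

Lemma foldl_orb (X : finType) (P : pred X) y :
  foldl (fun y s => y || P s) y (enum X) = y || [exists s, P s].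
Proof.
rewrite -has_enum; elim: (enum X) y => [|s ss IH] y /=; first by rewrite orbF.
by rewrite IH orbA.
Qed.

Lemma foldl_select (X : eqType) (Y : Type) (f : X -> Y) x y xs :
  foldl (fun y s => if s == x then f s else y) y xs =
  if x \in xs then f x else y.
Proof.
elim: xs y => //= s ss IH y; rewrite IH inE eq_sym.
by case: eqP => //= ->; rewrite if_same.
Qed.

Lemma foldl_mismatch c a p l f m x d (lab lab' : AP -> bool) :
  foldl (fun g a => mark_mismatch g (lab a) (lab' a))
    (c, a, p, l, f, m, x, d) (enum AP) =
  (c, a, p, l, f, m || (l && [exists a, lab a != lab' a]), x, d).
Proof.
rewrite -has_enum; elim: (enum AP) m => [|e es IH] m /=.
  by rewrite andbF orbF.
by rewrite IH; case: (l); rewrite /= ?orbF ?orbA.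
Qed.

Lemma exec_layer a x r p l f m x0 d lab R :
  exec N layer
    (cfg (word_tape _ [::] w) (word_tape _ a (encode_state x ++ r))
       (cells p l f m x0 d) (fun=> false) lab R)
    (cfg (word_tape _ [::] w) (word_tape _ (a ++ encode_state x) r)
       (cells (xpred1 x) (succs l) l
          (fun s => m s || (l s && (label T s != label T x))) x0 d)
       (fun=> false) (fun e => e \in label T x) R).
Proof.
set PA := word_tape _ (a ++ _) r.
exists (cfg (word_tape _ [::] w) PA (cells (xpred1 x) l f m x0 d)
          (fun=> false) lab R).
  have := @exec_scan_vector _ cell0 N true mark_path _
    (fun s => s \in [set x]) (fun s => flag (cells p l f m x0 d s)) (enum S)
    a r (word_tape _ [::] w) (zip_tape [::] [seq bit false | _ <- enum S])
    (zip_tape [::] [seq bit (lab a) | a <- enum AP]) (zip_tape [::] [:: R])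
    leq_states.
  move=> H; apply: (exec_to H).
  pose g s := mark_path (cells p l f m x0 d s) (s \in [set x]).
  by apply: (@eq_cfg _ _ g) => // s; rewrite /g /cells /= inE.
eexists; first exact: exec_skip.
eexists.
  apply: exec_to (exec_sweep_states _ _ _ _ _ _) _.
  apply: (@eq_cfg _ _ _ _ _ (succs l)) (fun=> erefl) _ (fun=> erefl) erefl => t.
  by rewrite foldl_orb.
eexists.
  apply: exec_to (exec_sweep_labels _ _ _ _ _ _) _.
  apply: (@eq_cfg _ _ _ _ _ _ _ (fun e => e \in label T x)) (fun=> erefl)
    (fun=> erefl) _ erefl => e.
  have := foldl_select (fun s => e \in label T s) x (lab e) (enum S).
  by rewrite mem_enum.
eexists; first by apply: exec_rewind_input; rewrite -!catA.
eexists; first exact: exec_skip.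
eexists.
  apply: exec_to (exec_sweep_states _ _ _ _ _ _) _.
  apply: (@eq_cfg _ _ _ _ _ (succs l)) (fun=> erefl) _ (fun=> erefl) erefl => t.
  by elim: (enum S).
eexists; first exact: exec_mismatch.
eexists; first by apply: exec_rewind_input; rewrite -!catA.
set g := fun s => foldl _ _ _.
have := @exec_pointwise _ cell0 N next_layer (fun _ y => y) _ g (succs l)
  (enum S) (word_tape _ [::] w) PA
  (zip_tape [::] [seq bit (e \in label T x) | e <- enum AP]) R leq_states.
have -> : foldl (fun y _ => y) R (enum S) = R by elim: (enum S).
move=> H.
apply: (exec_to H).
apply: (@eq_cfg _ _ (fun s => next_layer (g s) (succs l s))) => // s.
rewrite /g /cells foldl_mismatch /=.
congr (_, _, _, _, _, _ || (_ && _), _, _).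
apply/existsP/idP => [[e ne]|]; first by apply: contraNneq ne => ->.
rewrite eqEsubset => /nandP[] /subsetPn[e e1 e2]; exists e.
  by rewrite e1 (negbTE e2).
by rewrite e1 (negbTE e2).
Qed.

Lemma exec_prepare :
  exec N prepare
    (([::], [seq Some (inl a) | a <- w]) :: nseq 5 ([::], [::]))
    (cfg (word_tape _ [::] w) (word_tape _ [::] path)
       (cells xpred0 (xpred1 (init T)) xpred0 xpred0 xpred0 (xpred1 (init T)))
       (fun=> false) (fun=> false) None).
Proof.
(* A constant fold overwrites the initial blanks only if there is at least one row. *)
have S0 : exists s, enum S = s :: behead (enum S).
  by have := mem_enum S (init T); case: (enum S) => // s ss; exists s.
pose g0 s := mark_init cell0 (s \in [set init T]).
(* An empty tape equals a tape with any number of blanks, so the sweeps can treat unwritten cells as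
   entries. *)
pose Vn := zip_tape [::] [seq None | _ <- enum S] : tp.
pose Ln := zip_tape [::] [seq None | _ <- enum AP] : tp.
pose Rn := zip_tape [::] [seq None | _ <- [:: tt]] : tp.
rewrite -(zip_tape_word cell) /= -{2}(@zip_tape_blank cell S (enum S))
  -{2}(@zip_tape_blank cell S (enum S)) -{2}(@zip_tape_blank cell AP (enum AP))
  -{2}(@zip_tape_blank cell unit [:: tt]) -/Vn -/Ln -/Rn.
pose P0 := word_tape _ [::] [::] : tp.
exists [:: word_tape _ ini (adj ++ labs ++ tl); P0;
  zip_tape [::] [seq flag (g0 s) | s <- enum S]; Vn; Ln; Rn].
  exact: (@exec_scan_vector _ cell0 N false mark_init _
    (fun s => s \in [set init T]) (fun=> None) (enum S)
    [::] _ P0 _ _ _ leq_states).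
exists [:: word_tape _ (ini ++ adj) (labs ++ tl); P0;
  zip_tape [::] [seq flag (g0 s) | s <- enum S];
  zip_tape [::] [seq bit false | _ <- enum S]; Ln; Rn].
  have := (@exec_sweep_cols _ cell0 false (fun _ _ _ => false) (fun g _ _ => g)
    (fun _ _ _ => erefl) N S S
    (fun s t => t \in [set t | trans T s t]) g0 (fun t => None) (enum S)
    (enum S) ini (labs ++ tl) P0 Ln Rn leq_states leq_states
    (fun _ _ _ => erefl)).
  have -> : foldl (fun _ _ => bit false) None (enum S) = bit false.
    by case: S0 => s ->; elim: (behead _).
  by [].
exists (cfg (word_tape _ (ini ++ adj ++ labs) tl) P0 g0
          (fun=> false) (fun=> false) None).
  have := (@exec_sweep_cols _ cell0 true (fun _ _ _ => false) (fun g _ _ => g)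
    (fun _ _ _ => erefl) N S AP
    (fun s a => a \in label T s) g0 (fun t => None) (enum S)
    (enum AP) (ini ++ adj) tl P0
    (zip_tape [::] [seq bit false | _ <- enum S]) Rn
    leq_labels leq_states (fun _ _ _ => erefl)).
  have -> : foldl (fun _ _ => bit false) None (enum S) = bit false.
    by case: S0 => s ->; elim: (behead _).
  by rewrite -catA.
pose g1 s := mark_cause (g0 s) (s \in C).
pose g2 s := mark_aim (g1 s) (s \in A).
pose pre := ini ++ adj ++ labs.
pose pre' := rcons (pre ++ encode_set C) (Some kind).
exists (cfg
    (word_tape _ (pre ++ encode_set C) (Some kind :: encode_set A ++ path)) P0
    g1 (fun=> false) (fun=> false) None).
  exact: (@exec_scan_vector _ cell0 N false mark_cause _
    (fun s => s \in C) (fun s => flag (g0 s)) (enum S)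
    pre _ P0 _ _ _ leq_states).
exists (cfg (word_tape _ pre' (encode_set A ++ path)) P0 g1
          (fun=> false) (fun=> false) None).
  by rewrite /cfg /pre' /word_tape map_rcons; run_step.
exists (cfg (word_tape _ (pre' ++ encode_set A) path) P0 g2
          (fun=> false) (fun=> false) None).
  exact: (@exec_scan_vector _ cell0 N false mark_aim _
    (fun s => s \in A) (fun s => flag (g1 s)) (enum S)
    _ _ P0 _ _ _ leq_states).
have E : (pre' ++ encode_set A) ++ path = w.
  by rewrite /w /tl /pre' /pre cat_rcons -!catA.
have H := @exec_split_off cell N (pre' ++ encode_set A) path.
rewrite E in H; apply: (exec_to (H _ _ _ _ _)) => //.
by apply: (@eq_cfg _ _ g2) => // s; rewrite /g2 /g1 /g0 /cells /= inE.
Qed.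

Definition layer_step (z : (S -> bool) * (S -> bool) * (S -> bool)) (x : S) :=
  let: (l, f, m) := z in
  (succs l, l, fun s => m s || (l s && (label T s != label T x))).

(** The path marker [p'] and the copied label [lab'] are leftovers of the last round and stay
    unspecified. *)
Lemma exec_layers xs a p l f m x d lab R :
  exists p' lab',
  loop (fun r => nth None r 1 != None) (exec N layer) (size xs)
    (cfg (word_tape _ [::] w)
       (word_tape _ a (flatten [seq encode_state s | s <- xs]))
       (cells p l f m x d) (fun=> false) lab R)
    (let: (l', f', m') := foldl layer_step (l, f, m) xs in
     cfg (word_tape _ [::] w)
       (word_tape _ (a ++ flatten [seq encode_state s | s <- xs]) [::])
       (cells p' l' f' m' x d) (fun=> false) lab' R).
Proof.
elim: xs a p l f m lab => [|s xs IH] a p l f m lab.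
  by exists p, lab; rewrite /= cats0.
have [p' [lab' H]] := IH (a ++ encode_state s) (xpred1 s) (succs l) l
  (fun t => m t || (l t && (label T t != label T s)))
  (fun e => e \in label T s).
exists p', lab'; split.
  rewrite /= /word_tape read_zip map_cat.
  by rewrite /encode_state /encode_set map_rcons; case: (enum S).
eexists; first exact: exec_layer.
by move: H; rewrite -catA.
Qed.

Definition verdict_of (f x : S -> bool) : option bool :=
  if [exists s, [&& x s, f s & s \in A]] then Some false
  else if [exists s, x s && f s] then Some true else None.

Definition answer_of (o : option bool) : sym := omap (fun b => inl (Some b)) o.

Lemma foldl_judge (c p l f m x d : S -> bool) :
  foldl (fun y s => judge (c s, s \in A, p s, l s, f s, m s, x s, d s) y)
    None (enum S) = answer_of (verdict_of f x).
Proof.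
rewrite /verdict_of -!has_enum.
(* Generalized to every symbol that the fold may have left on the verdict tape. *)
suff H y ss : y \in [:: None; bit false; bit true] ->
  foldl (fun y s => judge (c s, s \in A, p s, l s, f s, m s, x s, d s) y) y ss =
  if (y == bit false) || has (fun s => [&& x s, f s & s \in A]) ss
  then bit false
  else if has (fun s => x s && f s) ss then bit true else y.
  by rewrite H //=; do 2?case: ifP.
elim: ss y => [|s ss IH] y yin /=; first by rewrite orbF; case: eqP.
rewrite IH; last first.
  move: yin; rewrite !inE; case: (x s && f s) => //.
  by case: (s \in A) => // /or3P[] /eqP->.
move: yin; rewrite !inE.
case: (x s); case: (f s); case: (s \in A) => //= /or3P[] /eqP-> //=;
by rewrite ?if_same //; do 2?case: ifP.
Qed.

Definition token_step (m : S -> bool) (z : (S -> bool) * (S -> bool)) :=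
  (fun t => (t \notin C) && (z.2 t || (~~ m t && succs z.1 t)),
   fun t => m t && succs z.1 t).

Fixpoint first_verdict f m n z : option bool :=
  if n is n'.+1 then
    let z' := token_step m z in
    if verdict_of f z'.1 is Some b then Some b else first_verdict f m n' z'
  else None.

Lemma exec_tick a y r p l f m z lab :
  let z' := token_step m z in
  exec N tick
    (cfg (word_tape _ [::] w) (word_tape _ a (y :: r))
       (cells p l f m z.1 z.2) (fun=> false) lab None)
    (cfg (word_tape _ [::] w) (word_tape _ (rcons a y) r)
       (cells p l f m z'.1 z'.2) (fun=> false) lab
       (answer_of (verdict_of f z'.1))).
Proof.
move=> z'.
eexists; first exact: exec_skip.
eexists.
  apply: exec_to (exec_sweep_states _ _ _ _ _ _) _.
  apply: (@eq_cfg _ _ _ _ _ (succs z.1)) (fun=> erefl) _ (fun=> erefl) erefl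
    => t.
  by rewrite foldl_orb.
eexists; first by apply: exec_rewind_input; rewrite -!catA.
exists (cfg (word_tape _ [::] w) (word_tape _ a (y :: r))
       (cells p l f m z'.1 z'.2) (fun=> false) lab
       (answer_of (verdict_of f z'.1))).
  have H := @exec_pointwise _ cell0 N move_tokens judge _
    (cells p l f m z.1 z.2) (succs z.1) (enum S)
    (word_tape _ [::] w) (word_tape _ a (y :: r))
    (zip_tape [::] [seq bit (lab e) | e <- enum AP]) None leq_states.
  apply: (exec_to H).
  pose g s := move_tokens (cells p l f m z.1 z.2 s) (succs z.1 s).
  apply: (@eq_cfg _ _ g) => //.
  exact: (foldl_judge (fun s => s \in C) p l f m z'.1 z'.2).
by rewrite /cfg /word_tape map_rcons; run_step.
Qed.

(** The loop stops at the first verdict or with the clock; in the latter case the blank verdict cell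
    encodes [None]. *)
Lemma exec_ticks r a p l f m z lab :
  exists n s', [/\ n <= size r,
  loop (fun r => (nth None r 1 != None) && (nth None r 5 == None))
    (exec N tick) n
    (cfg (word_tape _ [::] w) (word_tape _ a r)
       (cells p l f m z.1 z.2) (fun=> false) lab None) s'
  & nth None (reads s') 5 = answer_of (first_verdict f m (size r) z)].
Proof.
elim: r a z => [|y r IH] a z.
  exists 0; eexists; split; [by []| split; last by [] |].
    by rewrite /= /word_tape read_zip.
  by rewrite /= read_zip.
have H := exec_tick a y r p l f m z lab.
case E : (verdict_of f (token_step m z).1) => [b|].
  exists 1; eexists; split; [by []| |].
    split; first by rewrite /= /word_tape !read_zip.
    eexists; first exact: H.
    split; last by [].
    by rewrite /= /word_tape !read_zip E /= andbF.
  by rewrite /= read_zip E.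
have [n [s' [len Hl Hr]]] := IH (rcons a y) (token_step m z).
exists n.+1, s'; split; [by []| |]; last by rewrite Hr /= E.
split; first by rewrite /= /word_tape !read_zip.
by eexists; first exact: H; rewrite E.
Qed.

Lemma exec_program :
  exists2 s', exec N program
    (([::], [seq Some (inl a) | a <- w]) :: nseq 5 ([::], [::])) s' &
  accept (reads s') =
    (let: (l, f, m) := foldl layer_step (xpred1 (init T), xpred0, xpred0) pi in
     first_verdict f m (size path) (xpred0, xpred1 (init T)) == Some true).
Proof.
have [p [lab Hl]] := exec_layers pi [::] xpred0 (xpred1 (init T)) xpred0 xpred0
  xpred0 (xpred1 (init T)) (fun=> false) None.
case E : (foldl _ _ pi) Hl => [[l f] m] Hl.
have [n [s' [len Ht Hr]]] :=
  exec_ticks path [::] p l f m (xpred0, xpred1 (init T)) lab.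
exists s'; last by rewrite /accept Hr; case: first_verdict => [[]|].
eexists; first exact: exec_prepare.
eexists.
  exists (size pi); last exact: Hl.
  apply: leq_trans leq_path; rewrite /path.
  by elim: (pi) => //= s ss IH; rewrite size_cat size_encode_set; lia.
eexists.
  apply: (@exec_rewind_word _ N 1 (cfg _ _ _ _ _ _) ([::] ++ path) [::]) => //.
  exact: leq_path.
rewrite cats0; exists n; last exact: Ht.
exact: leq_trans len leq_path.
Qed.

End Correctness.

(** * Tokens and counterfactual causes *)

Section Paths.
Variables (S AP : finType) (T : transition_system S AP) (k : nat).
Hypothesis all_length_k : forall rho, maximal_path T rho -> has_length rho k.

Let successor (s : S) : S := odflt s [pick t | trans T s t].

Lemma trans_successor s : ~~ terminal T s -> trans T s (successor s).
Proof.
rewrite negb_forall => /existsP[t]; rewrite negbK => st.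
by rewrite /successor; case: pickP => [//|/(_ t)]; rewrite st.
Qed.

Lemma size_maximal_path p :
  path (trans T) (init T) p -> terminal T (last (init T) p) ->
  (size p).+1 = k.
Proof. by move=> pp tp; apply: (all_length_k (rho := Fin (init T :: p))). Qed.

(** Iterating a fixed successor function from the end of [p] meets a terminal state; otherwise it
    yields an infinite path, which is maximal but has no finite length. *)
Lemma extend_path p :
  path (trans T) (init T) p ->
  exists q, path (trans T) (init T) (p ++ q)
         /\ terminal T (last (init T) (p ++ q)).
Proof.
move=> pp; set x := last (init T) p.
case: (classic (exists j, terminal T (iter j successor x))) => [|stuck].
  move=> ex; case: (ex_minnP ex) => j tj minj.
  exists (traject successor (successor x) j).
  rewrite cat_path pp last_cat -/x last_traject; split=> //.
  have : forall i, i < j -> ~~ terminal T (iter i successor x).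
    by move=> i; apply: contraTN => /minj; rewrite leqNgt.
  elim: j (x) {ex tj minj} => //= j IH y H.
  rewrite trans_successor ?(H 0) //=; apply: IH => i lti.
  by rewrite -iterSr H.
pose f i := if i <= size p then nth (init T) (init T :: p) i
            else iter (i - size p) successor x.
case: (all_length_k (rho := Inf f)); split=> //; split=> // i; rewrite /f.
case: (ltngtP i (size p)) => [lti|lti|->].
- exact: (pathP (init T) pp).
- rewrite subSn ?(ltnW lti) //=; apply: trans_successor.
  by apply/negP => h; apply: stuck; exists (i - size p).
- rewrite subSnn /= -last_nth; apply: trans_successor.
  by apply/negP => h; apply: stuck; exists 0.
Qed.

Lemma size_path_lt p : path (trans T) (init T) p -> size p < k.
Proof.
move=> /extend_path[q [pq tq]]; rewrite -(size_maximal_path pq tq) size_cat.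
by rewrite ltnS leq_addr.
Qed.

Lemma terminal_full_path p :
  path (trans T) (init T) p -> (size p).+1 = k -> terminal T (last (init T) p).
Proof.
move=> /extend_path[q [pq tq]] sp; have := size_maximal_path pq tq; move: tq.
rewrite size_cat; case: q {pq} => [|y q]; first by rewrite cats0.
by move=> _ /=; lia.
Qed.

(* A common continuation to a terminal state turns both into maximal paths. *)
Lemma depth_unique p p' :
  path (trans T) (init T) p -> path (trans T) (init T) p' ->
  last (init T) p = last (init T) p' -> size p = size p'.
Proof.
move=> pp pp' El; have [q [pq tq]] := extend_path pp.
have pq' : path (trans T) (init T) (p' ++ q).
  by move: pq; rewrite !cat_path pp pp' El.
have tq' : terminal T (last (init T) (p' ++ q)).
  by rewrite last_cat -El -last_cat.
have := size_maximal_path pq tq; have := size_maximal_path pq' tq'.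
by rewrite !size_cat; lia.
Qed.

Definition path_to p s :=
  path (trans T) (init T) p /\ last (init T) p = s.

Lemma path_to_rcons p s t : path_to p s -> trans T s t -> path_to (rcons p t) t.
Proof. by case=> pp <- st; split; rewrite ?last_rcons // rcons_path pp. Qed.

Lemma path_to_rconsP p t u :
  path_to (rcons p t) u -> [/\ t = u, path_to p (last (init T) p)
                             & trans T (last (init T) p) t].
Proof. by case; rewrite rcons_path last_rcons => /andP[pp lt] <-. Qed.

(** Induction appends states at the end: the next state of the list sits at the depth of the current
    layer, whose mismatches are recorded before the layer advances. *)
Lemma layersP xs :
  let: (l, f, m) :=
    foldl (layer_step T) (xpred1 (init T), xpred0, xpred0) xs in
  [/\ forall s, l s <-> exists2 p, path_to p s & size p = size xs,
      forall s, f s <-> exists2 p, path_to p s & (size p).+1 = size xs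
    & forall s, m s <-> exists p, [/\ path_to p s, size p < size xs
        & label T s != label T (nth (init T) xs (size p))]].
Proof.
elim/last_ind: xs => [|xs x] /=.
  split=> [s|s|s]; split=> //.
  - by move=> /eqP->; exists [::].
  - by case=> p [_ <-] sp; rewrite (size0nil sp) /= eqxx.
  - by case=> p.
  - by case=> p [].
rewrite foldl_rcons size_rcons.
case: (foldl _ _ xs) => [[l f] m] [Hl Hf Hm] /=; split=> s.
- split=> [/existsP[r /andP[/Hl[p pr sp] rs]]|[p]].
    by exists (rcons p s); [exact: path_to_rcons pr rs | rewrite size_rcons sp].
  case/lastP: p => // p t /path_to_rconsP[-> pp lt].
  rewrite size_rcons => -[sp]; apply/existsP; exists (last (init T) p).
  by rewrite lt andbT; apply/Hl; exists p.
- split=> [/Hl[p ps sp]|[p ps [sp]]]; first by exists p; rewrite ?sp.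
  by apply/Hl; exists p.
- split=> [/orP[/Hm[p [ps sp ne]]|/andP[/Hl[p ps sp] ne]]|[p [ps sp ne]]].
  + by exists p; rewrite nth_rcons sp ltnS (ltnW sp).
  + by exists p; rewrite nth_rcons sp ltnn eqxx.
  + move: sp; rewrite ltnS leq_eqVlt => /orP[/eqP sp|sp].
      move: ne; rewrite nth_rcons sp ltnn eqxx => ne.
      by apply/orP; right; rewrite ne andbT; apply/Hl; exists p.
    by apply/orP; left; apply/Hm; exists p; move: ne; rewrite nth_rcons sp.
Qed.

(** * Arrival times of tokens *)

Section Tokens.
Variables (C : {set S}) (m : S -> bool).

Definition tokens n :=
  iter n (token_step T C m) (xpred0, xpred1 (init T)).

Definition avoiding p := all (fun s => s \notin C) (init T :: p).

(** Here [p] lists the states after the initial one, and the successor is the tick that places the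
    first token. A mismatch of [init T] would be common to all paths and causes no delay. *)
Definition arrival p := (size p + count m p).+1.

Lemma avoiding_rcons p t : avoiding (rcons p t) = (t \notin C) && avoiding p.
Proof. by rewrite /avoiding -rcons_cons all_rcons. Qed.

Lemma arrival_rcons p t : arrival (rcons p t) = (arrival p + m t).+1.
Proof. by rewrite /arrival size_rcons -cats1 count_cat /= addn0; lia. Qed.

Lemma tokensP n t :
  (tokens n).1 t <->
  exists p, [/\ path_to p t, avoiding p & arrival p = n].
Proof.
(* The induction also describes pending tokens: the initial one at time 0, and those sent into a
   mismatched state in the latest tick. They are tested against [C] only when they arrive. *)
suff [//] : (forall t, (tokens n).1 t <->
    exists p, [/\ path_to p t, avoiding p & arrival p = n]) /\
  (forall t, (tokens n).2 t <-> n = 0 /\ t = init T \/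
    m t /\ exists p s, [/\ path_to p s, avoiding p, trans T s t
                         & (arrival p).+1 = n]).
elim: n {t} => [|n [IH1 IH2]].
  split=> t; split=> //.
  - by case=> p [].
  - by move=> /eqP->; left.
  - by case=> [[_ ->]|[_ [p [s []]]]] //=; rewrite eqxx.
rewrite /tokens iterS -/(tokens n); split=> t /=; last first.
  split=> [/andP[mt /existsP[s /andP[/IH1[p [ps av ar]] st]]]|].
    by right; split=> //; exists p, s; rewrite ar.
  case=> [[]//|[mt [p [s [ps av st [ar]]]]]]; rewrite mt.
  by apply/existsP; exists s; rewrite st andbT; apply/IH1; exists p.
split.
  case/andP=> tC /orP[/IH2[[-> ti]|[mt [p [s [ps av st ar]]]]]|].
  - by exists [::]; rewrite /avoiding /= -ti tC.
  - exists (rcons p t); rewrite avoiding_rcons tC av arrival_rcons mt addn1 ar.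
    by split=> //; exact: path_to_rcons ps st.
  - case/andP=> /negbTE mt /existsP[s /andP[/IH1[p [ps av ar]] st]].
    exists (rcons p t); rewrite avoiding_rcons tC av arrival_rcons mt addn0 ar.
    by split=> //; exact: path_to_rcons ps st.
case=> p; case/lastP: p => [|p u] [].
  case=> _ /= <-; rewrite /avoiding /arrival /= andbT => -> [<-].
  by rewrite /= eqxx.
case/path_to_rconsP=> -> pp lt.
rewrite avoiding_rcons => /andP[tC av]; rewrite arrival_rcons tC /=.
case mt: (m t) => -[ar]; apply/orP; [left | right].
  apply/IH2; right; split=> //; exists p, (last (init T) p).
  by rewrite -ar addn1.
apply/existsP; exists (last (init T) p); rewrite lt andbT.
by apply/IH1; exists p; rewrite -ar addn0.
Qed.

End Tokens.

(** Verdicts are inspected after each tick and not before the first, hence the shift [j.+1]. *)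
Lemma first_verdictP C A f m n z b :
  first_verdict T C A f m n z = Some b <->
  exists2 j, j < n &
    verdict_of A f (iter j.+1 (token_step T C m) z).1 = Some b /\
    forall i, i < j -> verdict_of A f (iter i.+1 (token_step T C m) z).1 = None.
Proof.
elim: n z => [|n IH] z; first by split=> // -[].
pose z' := token_step T C m z.
rewrite -[first_verdict _ _ _ _ _ n.+1 z]/(if verdict_of A f z'.1 is Some c
  then Some c else first_verdict T C A f m n z').
case E: (verdict_of A f z'.1) => [c|].
  split=> [[<-]|[[|j] _ [Hj Hi]]]; first by exists 0.
    by rewrite -Hj -E.
  by have := Hi 0 isT; rewrite -[LHS]/(verdict_of A f z'.1) E.
rewrite IH; split=> [[j ltj [Hj Hi]]|[[|j] ltj [Hj Hi]]].
- exists j.+1 => //; split; first by rewrite iterSr.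
  by case=> [|i] lti; rewrite iterSr // Hi.
- by move: Hj; rewrite -[LHS]/(verdict_of A f z'.1) E.
- exists j => //; split; first by rewrite -iterSr.
  by move=> i lti; rewrite -iterSr Hi.
Qed.

End Paths.

Lemma sat_dia (S : finType) (w : seq S) (B : {set S}) :
  sat (Fin w) (Dia B) <-> has (fun s => s \in B) w.
Proof.
split=> [[i [s [Es sB]]]|/hasP[s /onthP[i Es] sB]]; last by exists i, s.
by apply/hasP; exists s => //; apply/onthP; exists i.
Qed.

Lemma sat_box (S : finType) (w : seq S) (B : {set S}) :
  sat (Fin w) (Box B) <-> all (fun s => s \in B) w.
Proof.
split=> [H|/allP H i s Es]; last by apply: H; apply/onthP; exists i.
by apply/allP => s /onthP[i Es]; exact: H Es.
Qed.

(** * First arrivals as closest paths avoiding the cause *)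

Section Decision.
Variables (S AP : finType) (T : transition_system S AP) (k : nat).
Hypothesis all_length_k : forall rho, maximal_path T rho -> has_length rho k.
Variables (C A : {set S}) (Phi : formula S) (pi : seq S).
Hypothesis pi_maximal : maximal_path T (Fin pi).
Hypothesis sat_last : forall p,
  path (trans T) (init T) p -> terminal T (last (init T) p) ->
  sat (Fin (init T :: p)) Phi <-> last (init T) p \in A.

Variables (l f m : S -> bool).
Hypothesis layersE :
  foldl (layer_step T) (xpred1 (init T), xpred0, xpred0) pi = (l, f, m).

Lemma size_pi : size pi = k.
Proof. exact: (all_length_k pi_maximal). Qed.

Lemma last_layerP s :
  f s <-> exists2 p, path_to T p s & (size p).+1 = k.
Proof. by have := layersP T pi; rewrite layersE size_pi => -[]. Qed.

(** A path witnessing the mismatch has the same length as [p] by [depth_unique], so both are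
    compared with the same state of [pi]. *)
Lemma mismatchP p :
  path (trans T) (init T) p ->
  m (last (init T) p) =
    (label T (nth (init T) pi (size p)) != label T (last (init T) p)).
Proof.
move=> pp; have := layersP T pi; rewrite layersE size_pi => -[_ _ Hm].
apply/idP/idP => [/Hm[q [[pq Eq] sq]]|ne].
  by rewrite (depth_unique all_length_k pp pq (esym Eq)) eq_sym.
by apply/Hm; exists p; split; rewrite 1?eq_sym ?(size_path_lt all_length_k pp).
Qed.

Lemma hamming_rcons (X : eqType) (u v : seq X) x y :
  size u = size v ->
  hamming (rcons u x) (rcons v y) = hamming u v + (x != y).
Proof.
by move=> E; rewrite /hamming zip_rcons // -cats1 count_cat /= addn0.
Qed.

(** Cutting [pi] to the length of the prefix makes induction on the prefix possible. *)
Lemma hamming_mismatch p :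
  path (trans T) (init T) p ->
  hamming [seq label T s | s <- take (size p).+1 pi]
          [seq label T s | s <- init T :: p] = count m (init T :: p).
Proof.
elim/last_ind: p => [|p t IH] pp.
  have := mismatchP pp; have := size_path_lt all_length_k pp.
  by rewrite -size_pi; case: (pi) => //= s ss _ ->; rewrite take0.
have := mismatchP pp; have := size_path_lt all_length_k pp.
rewrite -size_pi size_rcons last_rcons => lt Em.
move: pp; rewrite rcons_path => /andP[pp _].
rewrite (take_nth (init T)) // -rcons_cons !map_rcons hamming_rcons.
  by rewrite IH // -Em -cats1 count_cat /= addn0.
by rewrite !size_map size_take lt.
Qed.

Lemma d_hammE p :
  path (trans T) (init T) p -> terminal T (last (init T) p) ->
  d_hamm T (Fin pi) (Fin (init T :: p)) = count m (init T :: p).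
Proof.
move=> pp tp; rewrite -hamming_mismatch //.
by rewrite (size_maximal_path all_length_k pp tp) -size_pi take_size.
Qed.

Definition avoiding_run p :=
  [/\ path (trans T) (init T) p, terminal T (last (init T) p)
    & avoiding T C p].

(** A path ending in the last layer has [k] states, so its arrival time is [k] plus the mismatches
    after the initial state. *)
Lemma arrivedP n s :
  (tokens T C m n).1 s && f s <->
  exists p, [/\ avoiding_run p, last (init T) p = s & k + count m p = n].
Proof.
split=> [/andP[/tokensP[p [[pp lp] av ar]] /last_layerP[q [pq lq] sq]]|].
  have sp := depth_unique all_length_k pp pq (etrans lp (esym lq)).
  have sk : (size p).+1 = k by rewrite sp.
  exists p; split=> //; last by rewrite -sk -ar.
  by split=> //; exact: (terminal_full_path all_length_k pp sk).
case=> p [[pp tp av] lp ar]; have sk := size_maximal_path all_length_k pp tp.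
apply/andP; split; last by apply/last_layerP; exists p.
by apply/tokensP; exists p; split=> //; rewrite /arrival -addSn sk.
Qed.

Lemma avoidingP rho :
  (maximal_path T rho /\ ~ sat rho (Dia C)) <->
  exists2 p, rho = Fin (init T :: p) & avoiding_run p.
Proof.
split=> [[mr nC]|[p ->] [pp tp av]]; last first.
  split; first by split.
  by move/sat_dia/hasP=> -[s /(allP av)/negP].
case: rho mr nC (all_length_k mr) => [[|s p]|//] [] //= [-> pp] tp nC _.
exists p; split=> //; apply/allP => s' s'p; apply/negP => s'C.
by apply: nC; apply/sat_dia/hasP; exists s'.
Qed.

Lemma sat_box_compl rho : sat rho (Box (~: C)) <-> ~ sat rho (Dia C).
Proof.
split=> /= [H [i [s [Es sC]]]|H i s Es].
  by have := H i s Es; rewrite inE sC.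
by rewrite inE; apply/negP => sC; apply: H; exists i, s.
Qed.

Lemma avoidsP rho :
  (maximal_path T rho /\ sat rho (Box (~: C))) <->
  exists2 p, rho = Fin (init T :: p) & avoiding_run p.
Proof.
rewrite -avoidingP.
by split=> -[mr /sat_box_compl H]; split=> //; apply/sat_box_compl.
Qed.

(** With the initial summand cancelled, arrival times of complete runs stay below [2 * k], within
    the clock. *)
Lemma count_mismatch_lt p :
  path (trans T) (init T) p -> count m (init T :: p) < k + (m (init T) : nat).
Proof.
move=> pp /=; rewrite addnC ltn_add2r.
exact: leq_ltn_trans (count_size _ _) (size_path_lt all_length_k pp).
Qed.

Lemma verdict_NoneP (x : S -> bool) :
  verdict_of A f x = None <-> forall s, x s && f s = false.
Proof.
rewrite /verdict_of; split=> [|H].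
  do 2?case: ifP => //; move=> /existsPn H _ _ s; exact/negbTE.
rewrite !(introF existsP) //; first by case=> s; rewrite H.
by case=> s; rewrite andbA H.
Qed.

Lemma verdict_trueP (x : S -> bool) :
  verdict_of A f x = Some true <->
  (exists s, x s && f s) /\ forall s, x s && f s -> s \notin A.
Proof.
rewrite /verdict_of; split=> [|[/existsP ex H]].
  case: ifP => // /existsPn H; case: ifP => // /existsP ex _; split=> // s xf.
  by have := H s; rewrite andbA xf.
rewrite ifN ?ex //; apply/existsPn => s; rewrite andbA negb_and.
by case xf: (x s && f s) => //=; exact: H.
Qed.

(** Forwards, a closest avoiding path must arrive exactly at the first verdict. Backwards, the first
    condition of causality provides an arrival, and the second is applied to all arrivals at the
    earliest time. *)
Lemma first_verdict_cause B : 2 * k <= B ->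
  first_verdict T C A f m B (xpred0, xpred1 (init T)) = Some true <->
  counterfactual_cause T (d_hamm T) C Phi (Fin pi).
Proof.
move=> leB; rewrite first_verdictP; split=> [[n ltn [Hn Hlt]]|].
  move: Hn; rewrite verdict_trueP => -[[s0 /arrivedP[p0 [r0 _ a0]]] notA].
  split; first by exists (Fin (init T :: p0)); apply/avoidingP; exists p0.
  move=> rho [mr br] rmin.
  have [p Er rp] := (avoidsP rho).1 (conj mr br).
  have [pp tp _] := rp; have [pp0 tp0 _] := r0.
  (* Both distances contain the same summand for the initial state, which cancels. *)
  have le0 : count m p <= count m p0.
    have := rmin (Fin (init T :: p0)).
    rewrite Er !d_hammE // leEnat /= leq_add2l.
    by apply; apply/avoidsP; exists p0.
  have ar : (tokens T C m (k + count m p)).1 (last (init T) p)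
            && f (last (init T) p).
    by apply/arrivedP; exists p.
  (* A later arrival contradicts [le0], an earlier one the absence of previous verdicts. *)
  rewrite Er sat_last // => lA; suff En : k + count m p = n.+1.
    have := notA (last (init T) p).
    by rewrite lA -/(tokens T C m n.+1) -En ar => /(_ isT).
  case: (ltngtP (k + count m p) n.+1) => // [|]; last by lia.
  have : 0 < k + count m p by have := size_path_lt all_length_k pp; lia.
  case E : (k + count m p) ar => [//|j] ar _ ltj.
  have /verdict_NoneP/(_ (last (init T) p)) := Hlt j ltj.
  by rewrite -/(tokens T C m j.+1) ar.
case=> [[rho /avoidingP[p Er rp]] Hmin].
have [pp tp _] := rp.
have ex : exists n, [exists s, (tokens T C m n).1 s && f s].
  exists (k + count m p); apply/existsP; exists (last (init T) p).
  by apply/arrivedP; exists p.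
case: (ex_minnP ex) => n /existsP[s xs] minn.
have /arrivedP[q [rq lq En]] := xs; have [pq tq _] := rq.
have := count_mismatch_lt pq; rewrite /= => ltq.
case: n En xs minn => [|n] En xs minn; first by lia.
exists n; first by lia.
split; last first.
  move=> i lti; apply/verdict_NoneP => t; apply/negP => xt.
  have := minn i.+1; rewrite ltnS leqNgt lti => /(_ _)/negP; apply; last by [].
  by apply/existsP; exists t.
apply/verdict_trueP; split; first by exists s.
move=> t xt.
have /arrivedP[u [ru lu Eu]] : (tokens T C m n.+1).1 t && f t by [].
have [pu tu _] := ru; rewrite -lu.
(* The run [u] arrives at the earliest time, so it is closest among the avoiding paths. *)
apply/negP => /(sat_last pu tu); apply: Hmin.
  by apply/avoidsP; exists u.
move=> rho' /avoidsP[v -> rv].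
have [pv tv _] := rv; rewrite !d_hammE // leEnat /= leq_add2l.
have := minn (k + count m v); rewrite -Eu leq_add2l; apply.
by apply/existsP; exists (last (init T) v); apply/arrivedP; exists v.
Qed.

End Decision.

(** * Formulas determined by the last state, and decidability *)

Lemma terminal_last (S AP : finType) (T : transition_system S AP) x p y :
  path (trans T) x p -> y \in x :: p -> terminal T y -> y = last x p.
Proof.
move=> pp yp ty; case/splitPl: yp pp => p1 p2 Ey.
rewrite cat_path last_cat Ey; case: p2 => //= z p2 /and3P[_ yz _].
by have /forallP/(_ z) := ty; rewrite yz.
Qed.

(** A path can meet [E] only in its last state. Thus in both cases the encoded set, [E] or its
    complement, is the set of last states satisfying the formula. *)
Lemma sat_terminal (S AP : finType) (T : transition_system S AP) (E : {set S})
    (Phi : formula S) :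
  (forall s, s \in E -> terminal T s) ->
  Phi = Dia E \/ Phi = Box (~: E) ->
  exists kind A, encode_formula Phi = Some kind :: encode_set A /\
  forall p, path (trans T) (init T) p -> terminal T (last (init T) p) ->
  sat (Fin (init T :: p)) Phi <-> last (init T) p \in A.
Proof.
move=> tE; case=> ->.
  exists true, E; split=> // p pp tp; rewrite sat_dia.
  split=> [/hasP[s sp sE]|lE].
    by rewrite -(terminal_last pp sp (tE _ sE)).
  by apply/hasP; exists (last (init T) p); rewrite ?mem_last.
exists false, (~: E); split=> // p pp tp; rewrite sat_box.
split=> [/allP H|lE].
  by apply: H; exact: mem_last.
apply/allP => s sp; rewrite inE; apply/negP => sE.
by move: lE; rewrite inE -(terminal_last pp sp (tE _ sE)) sE.
Qed.

Theorem theorem2 :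
  exists (M : turing_machine letter) (c : nat),
  forall (S AP : finType) (T : transition_system S AP) (k : nat)
    (E C : {set S}) (Phi : formula S) (pi : seq S),
  (forall rho : state_sequence S, maximal_path T rho -> has_length rho k) ->
  (forall s : S, s \in E -> terminal T s) ->
  (forall s t : S, s \in E -> t \in E -> label T s = label T t) ->
  [disjoint C & E] ->
  Phi = Dia E \/ Phi = Box (~: E) ->
  maximal_path T (Fin pi) ->
  sat (Fin pi) (Dia C) ->
  sat (Fin pi) Phi ->
  let w := encode_instance T C Phi pi in
  exists b : bool,
    answers_within M w (c * size w ^ c + c) b /\
    (b <-> counterfactual_cause T (d_hamm T) C Phi (Fin pi)).
Proof.
(* Five tapes besides the input; [c] depends on the program alone. *)
have [c Hc] := compile_answers 5 program accept.
exists (compile 5 program accept), c.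
move=> S AP T k E C Phi pi Hk tE _ _ HPhi mpi _ _ w.
have [kind [A [encPhi satA]]] := sat_terminal tE HPhi.
have [s' Hs' acc] := exec_program T C A kind pi.
case El : (foldl _ _ pi) acc => [[l f] m] acc.
have Ew : w = encode_state (init T) ++
  flatten [seq encode_set [set t | trans T s t] | s <- enum S] ++
  flatten [seq encode_set (label T s) | s <- enum S] ++
  encode_set C ++ Some kind :: encode_set A ++
  flatten [seq encode_state s | s <- pi].
  by rewrite /w /encode_instance /encode_system encPhi -!catA.
rewrite -Ew in Hs' acc; exists (accept (reads s')); split; first exact: Hc.
(* Every state block has at least two letters, a bit for [init T] and the separator, so the clock is
   long enough. *)
have leB : 2 * k <= size (flatten [seq encode_state s | s <- pi]).
  rewrite -(size_pi Hk mpi).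
  have S0 : 0 < size (enum S).
    by rewrite -cardE; apply/card_gt0P; exists (init T).
  by elim: (pi) => //= s ss; rewrite size_cat size_encode_set; lia.
apply: iff_trans (first_verdict_cause Hk C mpi satA El leB).
by rewrite acc; split=> /eqP.
Qed.
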